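(* Let $\kappa\ge1$ and $C_w>0$. There exist constants $\delta_0=\delta_0(\kappa,C_w)>0$, $n_0=n_0(\kappa,C_w)\in\mathbb N$ and $C_{\kappa,C_w}>0$ such that the following holds. Consider a weighted cycle on $n$ vertices whose conductances satisfy $1\le c_i\le\kappa$ for $i=0,\dots,n-1$, and a chord conductance $w>0$ satisfying $1/w\le C_w\bar r$. Assume $\delta_n\le\delta_0$ and $n\ge n_0$. Let $$r_{\max}\le\zeta\le S/8,\qquad \mathcal A_\zeta:=\left\{(p,q):\left|d_R(p,q)-\frac S2\right|\le\zeta\right\},$$ and let $(\widehat p,\widehat q)\in\mathcal A_\zeta$ maximize $|\beta_1(p,q)|$ over $\mathcal A_\zeta$. Then $$0\le\max_{\{p,q\}\in\mathcal E_{\mathrm{ch}}}\Delta_{p,q}(w)-\Delta_{\widehat p,\widehat q}(w)\le C_{\kappa,C_w}(\lambda_2-\lambda_1)\left[\left(\frac\zeta S\right)^2+\sqrt{\delta_n}\right].$$ In particular, $$0\le\max_{\{p,q\}\in\mathcal E_{\mathrm{ch}}}\Delta_{p,q}(w)-\Delta_{\widehat p,\widehat q}(w)\le C_{\kappa,C_w}\frac wn\left[\left(\frac\zeta S\right)^2+\sqrt{\delta_n}\right].$$ For the native choice $\zeta=r_{\max}$, which is admissible (i.e. $r_{\max}\le S/8$) for all $n\ge8\kappa$, $$0\le\max_{\{p,q\}\in\mathcal E_{\mathrm{ch}}}\Delta_{p,q}(w)-\Delta_{\widehat p,\widehat q}(w)\le C_{\kappa,C_w}\frac wn\sqrt{\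delta_n}.$$
   Context: The weighted cycle has vertices $v_0,\dots,v_{n-1}$ and edges $\{v_i,v_{i+1}\}$ (indices mod $n$) with conductances $c_i=c_{i,i+1}>0$; $r_i:=1/c_i$. Its Laplacian is $L=D-A$, with eigenvalues $0=\lambda_0<\lambda_1\le\lambda_2\le\cdots\le\lambda_{n-1}$ and orthonormal eigenbasis $\boldsymbol u_0=\boldsymbol1/\sqrt n,\boldsymbol u_1,\dots,\boldsymbol u_{n-1}$. $\beta_1(p,q):=u_{1,p}-u_{1,q}$, where $u_{1,i}$ is the $i$th entry of $\boldsymbol u_1$. $L_{p,q}(w):=L+w(\boldsymbol e_p-\boldsymbol e_q)(\boldsymbol e_p-\boldsymbol e_q)^\top$ and $\Delta_{p,q}(w):=\lambda_1(L_{p,q}(w))-\lambda_1(L)$, where $\lambda_1(\cdot)$ is the second smallest eigenvalue. $\mathcal E_{\mathrm{ch}}$ is the set of unordered pairs $\{p,q\}$ of distinct vertices that are nonadjacent on the cycle. $S:=\sum_{i=0}^{n-1}r_i$, $\bar r:=S/n$, $r_{\max}:=\max_ir_i$, $s_0:=0$, $s_i:=\sum_{k=0}^{i-1}r_k$, and $d_R(p,q):=\min\{|s_p-s_q|,\,S-|s_p-s_q|\}$. For $1\le\ell\le n$, $A_{p,\ell}:=\sum_{j=0}^{\ell-1}r_{p+j}$ (indices mod $n$), and $$D:=\max_{0\le p\le n-1}\max_{1\le\ell\le n}\left|A_{p,\ell}-\frac\ell nS\right|,\quad \Delta:=\frac DS,\quad \eta:=\frac{r_{\max}}S,\quad \delta_n:=\Delta+\eta.$$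 (The scalar $\Delta$ without subscript is the discrepancy; $\Delta_{p,q}(w)$ is the gain.) *)

(* Defs.v *)
From HB Require Import structures.
From mathcomp Require Import all_boot all_order all_algebra.
From mathcomp Require Import boolp classical_sets reals.

Set Implicit Arguments.
Unset Strict Implicit.
Unset Printing Implicit Defensive.

Import Order.TTheory GRing.Theory Num.Theory.
Local Open Scope ring_scope.

Section Eigen.
Variables (R : realType) (n : nat).
Implicit Types (M : 'M[R]_n) (u : nat -> 'cV[R]_n).

(* Nondecreasing list of the eigenvalues with multiplicity. It is determined
   by M when char_poly M splits over R, in particular when M is symmetric;
   otherwise it is the empty list. *)
Definition eigenvalues M : seq R :=
  xget [::] [set s : seq R | sorted <=%R s
                           /\ char_poly M = \prod_(x <- s) ('X - x%:P)]%classic.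

Definition lambda M (k : nat) : R := (eigenvalues M)`_k.

(* Only u 0, ..., u n.-1 are constrained. *)
Definition orthonormal_eigenbasis M u : Prop :=
  (forall j k, (j < n)%N -> (k < n)%N -> (u j)^T *m u k = (j == k)%:R%:M) /\
  (forall k, (k < n)%N -> M *m u k = lambda M k *: u k).

Definition beta1 u (p q : 'I_n) : R := u 1%N p 0 - u 1%N q 0.

End Eigen.

Section WeightedCycle.
Variables (R : realType) (n : nat) (c : 'I_n -> R).
Implicit Types (p q : 'I_n) (w zeta : R).

(* c i is the conductance of the edge {i, ordS i}. The formula is the adjacency
   matrix of the cycle only for 3 <= n (no parallel edges). *)
Definition cycle_adj : 'M[R]_n :=
  \matrix_(i, j) ((j == ordS i)%:R * c i + (i == ordS j)%:R * c j).

Definition cycle_deg : 'M[R]_n := diag_mx (\row_i \sum_j cycle_adj i j).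

Definition laplacian : 'M[R]_n := cycle_deg - cycle_adj.

Definition evec p : 'cV[R]_n := delta_mx p 0.

Definition laplacian_chord p q w : 'M[R]_n :=
  laplacian + w *: ((evec p - evec q) *m (evec p - evec q)^T).

Definition gain w p q : R :=
  lambda (laplacian_chord p q w) 1 - lambda laplacian 1.

(* The set of chords is represented by ordered pairs; gain w is symmetric. *)
Definition chord p q : bool := [&& p != q, q != ordS p & p != ordS q].

(* The supremum over a finite set, hence a maximum as soon as a chord exists. *)
Definition max_gain w : R :=
  sup [set gain w pq.1 pq.2 | pq in [set pq : 'I_n * 'I_n | chord pq.1 pq.2]]%classic.

Definition res (i : 'I_n) : R := (c i)^-1.

Definition total_res : R := \sum_i res i.

Definition mean_res : R := total_res / n%:R.

(* Maxima of nonnegative quantities may be initialized at 0. *)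
Definition max_res : R := \big[Num.max/0]_i res i.

Definition pos p : R := \sum_(k < n | (k < p)%N) res k.

Definition res_dist p q : R :=
  Num.min `|pos p - pos q| (total_res - `|pos p - pos q|).

Definition arc_res p (l : nat) : R := \sum_(j < l) res (iter j (@ordS n) p).

Definition max_discr : R :=
  \big[Num.max/0]_p \big[Num.max/0]_(1 <= l < n.+1)
    `|arc_res p l - l%:R / n%:R * total_res|.

Definition discrepancy : R := max_discr / total_res.

Definition max_res_ratio : R := max_res / total_res.

Definition delta_n : R := discrepancy + max_res_ratio.

Definition near_antipodal zeta p q : Prop :=
  `|res_dist p q - total_res / 2| <= zeta.

Definition beta1_maximizer (u : nat -> 'cV[R]_n) zeta p q : Prop :=
  near_antipodal zeta p q /\
  forall p' q', near_antipodal zeta p' q' ->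
    `|beta1 u p' q'| <= `|beta1 u p q|.

End WeightedCycle.

(* Main.v *)
Require Import Defs.
From HB Require Import structures.
From mathcomp Require Import all_boot all_order all_algebra.
From mathcomp Require Import boolp classical_sets reals.
From mathcomp Require Import perm complex spectral.
From mathcomp Require Import topology normedtype derive realfun trigo.
From mathcomp Require Import ring lra.

Set Implicit Arguments.
Unset Strict Implicit.
Unset Printing Implicit Defensive.

Import Order.TTheory GRing.Theory Num.Theory.
Import numFieldNormedType.Exports.
Local Open Scope ring_scope.

(** Write g = lambda_2 - lambda_1, S for the total resistance, delta for
    delta_n and b = e_p - e_q. Since L + w b b^T is a rank one perturbation of
    L, interlacing bounds every gain by g (gain_le_gap), so it suffices to show
    that the chosen chord gains at least g (1 - O(delta)), as
    delta <= sqrt delta. The bound with w / n follows from g = O(1 / (n S)) and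
    1 / w <= C_w S / n.

    On the orthogonal of the constants, the form of L + w b b^T - mu is negative
    in the single direction u_1 when lambda_1 <= mu < lambda_2, and the
    Cauchy-Schwarz inequality absorbs this direction in the others and in the
    term w (b . v)^2 as soon as
      (mu - lambda_1) (1/w + beta_2^2 / (lambda_2 - mu) + 2 S) <= beta_1^2,
    where beta_k is the drop of u_k between p and q (secular_ineq, gain_lower).
    Taking mu = lambda_1 + g (1 - tau) with tau = O(delta), this needs three
    facts: lambda_3 >= 2 lambda_2, a gap g = O(delta / (n S)), and
    beta_1^2 >= 6 / n together with beta_2^2 = O(delta / n).

    All three come from the shape of the low eigenvectors. The eigenvector
    equation is a recurrence for the potential V_k and the flux h_k along the
    cycle. Let d_k be the deviation of the resistance position of vertex k from
    its mean value k S / n. The corrected potential V_k - d_k h_k and the flux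
    satisfy the recurrence of the uniform cycle up to errors of relative size
    delta / n per step, that is, a rotation by omega = sqrt (lambda S / n). Going
    once around the cycle, periodicity forces omega n to be close to a multiple
    of 2 pi (shooting_period), and if omega n lies in [1, 3 pi] the multiple is
    2 pi itself and sqrt (n/2) V_k is x cos (2 pi k / n) + y sin (2 pi k / n) up
    to O(delta), for some constants x and y (shooting_profile,
    eigenvector_profile). Orthonormality of eigenvectors passes to the pairs
    (x, y). A trial space puts lambda_1 and lambda_2 in this range (lambda2_le),
    so that both are (2 pi)^2 / (n S) up to O(delta); lambda_3 lies above it,
    because three vectors of a plane are not nearly orthonormal (lambda3_ge).

    Finally |beta_1| is maximal, about 2 sqrt (2/n), at a pair of antipodal
    points aligned with the phase of u_1, and such a pair exists among the
    nearly antipodal ones up to O(delta) (wave_peak, native_antipode). Bessel's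
    inequality in the plane gives beta_1^2 + beta_2^2 <= (8/n) (1 + O(delta)),
    so that the maximizer of |beta_1| has a small beta_2 (maximizer_modes). *)

(** * The spectral theorem for real symmetric matrices *)

Section Dot.
Variables (R : realType) (n : nat).
Implicit Types (x y z : 'cV[R]_n) (M : 'M[R]_n).

Definition dot x y : R := \sum_i x i 0 * y i 0.

Lemma dotE x y : x^T *m y = (dot x y)%:M.
Proof.
apply/matrixP=> i j; rewrite !ord1 !mxE eqxx mulr1n.
by apply: eq_bigr => k _; rewrite mxE.
Qed.

Lemma dotC x y : dot x y = dot y x.
Proof. by apply: eq_bigr => i _; rewrite mulrC. Qed.

Lemma dotDl x y z : dot (x + y) z = dot x z + dot y z.
Proof. by rewrite -big_split; apply: eq_bigr => i _; rewrite mxE mulrDl. Qed.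

Lemma dotZl a x y : dot (a *: x) y = a * dot x y.
Proof. by rewrite mulr_sumr; apply: eq_bigr => i _; rewrite mxE mulrA. Qed.

Lemma dotDr x y z : dot x (y + z) = dot x y + dot x z.
Proof. by rewrite !(dotC x) dotDl. Qed.

Lemma dotZr a x y : dot x (a *: y) = a * dot x y.
Proof. by rewrite !(dotC x) dotZl. Qed.

Lemma dot0l x : dot 0 x = 0.
Proof. by rewrite -(scale0r x) dotZl mul0r. Qed.

Lemma dotNl x y : dot (- x) y = - dot x y.
Proof. by rewrite -scaleN1r dotZl mulN1r. Qed.

Lemma dotNr x y : dot x (- y) = - dot x y.
Proof. by rewrite dotC dotNl dotC. Qed.

Lemma dot_suml I (r : seq I) (F : I -> 'cV[R]_n) y :
  dot (\sum_(i <- r) F i) y = \sum_(i <- r) dot (F i) y.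
Proof.
elim/big_rec2: _ => [|i a b _ <-]; first exact: dot0l.
by rewrite dotDl.
Qed.

Lemma dot_ge0 x : 0 <= dot x x.
Proof. by apply: sumr_ge0 => i _; rewrite -expr2 sqr_ge0. Qed.

Lemma dot_eq0 x : dot x x = 0 -> x = 0.
Proof.
move=> /eqP; rewrite psumr_eq0; last by move=> i _; rewrite -expr2 sqr_ge0.
move=> /allP h; apply/colP => i; rewrite mxE; apply/eqP.
by have := h i (mem_index_enum i); rewrite -expr2 sqrf_eq0.
Qed.

Lemma dot_gt0 x : x != 0 -> 0 < dot x x.
Proof.
move=> x0; rewrite lt_neqAle dot_ge0 andbT eq_sym.
by apply: contra x0 => /eqP /dot_eq0 ->.
Qed.

Lemma dot_sym M x y : M^T = M -> dot x (M *m y) = dot (M *m x) y.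
Proof.
move=> sM; have: (dot x (M *m y))%:M = (dot (M *m x) y)%:M :> 'M_1.
  by rewrite -!dotE trmx_mul sM mulmxA.
by move/matrixP/(_ 0 0); rewrite !mxE !mulr1n.
Qed.

End Dot.

(** The coefficients form a kernel vector of the matrix of the inner products,
    whose rank is at most k. All the min-max arguments start from it. *)
Lemma nonzero_comb (R : realType) (n m k : nat) (W : 'I_m -> 'cV[R]_n)
    (z : 'I_k -> 'cV[R]_n) : (k < m)%N ->
  exists2 t : 'I_m -> R, exists i, t i != 0 &
    forall j, dot (\sum_i t i *: W i) (z j) = 0.
Proof.
move=> km; pose A : 'M[R]_(m, k) := \matrix_(i, j) dot (W i) (z j).
have: kermx A != 0.
  rewrite kermx_eq0 /row_free; apply/eqP => e.
  by have := rank_leq_col A; rewrite e leqNgt km.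
case/rowV0Pn => t /sub_kermxP tA t0.
exists (fun i => t 0 i).
  apply/existsP; move: t0; apply: contraR; rewrite negb_exists => /forallP h.
  by apply/eqP/rowP => i; rewrite mxE; apply/eqP; rewrite -[_ == _]negbK h.
move=> j; rewrite dot_suml; have /rowP/(_ j) := tA; rewrite !mxE => h.
by rewrite -[RHS]h; apply: eq_bigr => i _; rewrite dotZl mxE.
Qed.

Section Spectral.
Variable R : realType.

(** Over the complex numbers there is an eigenvector x + i y, say for a. By
    symmetry Im a (|x|^2 + |y|^2) = 0, so that a is real and both x and y satisfy
    the eigenvector equation; one of them is nonzero. *)
Lemma symm_eigenvector n (M : 'M[R]_n.+1) : M^T = M ->
  exists (a : R) (v : 'cV[R]_n.+1), dot v v = 1 /\ M *m v = a *: v.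
Proof.
move=> sM; pose MC := map_mx (real_complex R) M.
have [a /eigenvalueP [v vM v0]] := @eigenvalue_closed _ _ MC (ltn0Sn n).
pose x : 'cV[R]_n.+1 := \col_i complex.Re (v 0 i).
pose y : 'cV[R]_n.+1 := \col_i complex.Im (v 0 i).
have sME i j : M i j = M j i by rewrite -{1}sM mxE.
have ReS (I : finType) (F : I -> R[i]) :
    complex.Re (\sum_i F i) = \sum_i complex.Re (F i).
  elim/big_rec2: _ => // i p q _ <-.
  by case: (F i) q => ? ? [].
have ImS (I : finType) (F : I -> R[i]) :
    complex.Im (\sum_i F i) = \sum_i complex.Im (F i).
  elim/big_rec2: _ => // i p q _ <-.
  by case: (F i) q => ? ? [].
have Mx : M *m x = complex.Re a *: x - complex.Im a *: y.
  apply/colP => i; have /rowP/(_ i) := vM; rewrite !mxE => /(congr1 (@complex.Re R)).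
  rewrite ReS; case: a {vM} (v 0 i) => a1 a2 [v1 v2] /= <-.
  apply: eq_bigr => j _; rewrite !mxE sME /=; case: (v 0 j) => p q /=; ring.
have My : M *m y = complex.Re a *: y + complex.Im a *: x.
  apply/colP => i; have /rowP/(_ i) := vM; rewrite !mxE => /(congr1 (@complex.Im R)).
  rewrite ImS; case: a {vM Mx} (v 0 i) => a1 a2 [v1 v2] /= <-.
  apply: eq_bigr => j _; rewrite !mxE sME /=; case: (v 0 j) => p q /=; ring.
have nz : 0 < dot x x + dot y y.
  rewrite lt_neqAle addr_ge0 ?dot_ge0 // andbT eq_sym.
  rewrite paddr_eq0 ?dot_ge0 //; apply: contra v0.
  move=> /andP[/eqP/dot_eq0 hx /eqP/dot_eq0 hy]; apply/eqP/rowP => i.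
  move/colP/(_ i): hx; move/colP/(_ i): hy; rewrite !mxE.
  by case: (v 0 i) => p q /= -> ->.
have a20 : complex.Im a = 0.
  have := dot_sym x y sM; rewrite Mx My dotDr dotDl dotNl !dotZl !dotZr => e.
  have /eqP : complex.Im a * (dot x x + dot y y) = 0 by lra.
  by rewrite mulf_eq0 (gt_eqF nz) orbF => /eqP.
have norm (z : 'cV[R]_n.+1) : z != 0 -> M *m z = complex.Re a *: z ->
  exists (a : R) (v : 'cV[R]_n.+1), dot v v = 1 /\ M *m v = a *: v.
  move=> z0 Mz; exists (complex.Re a), ((Num.sqrt (dot z z))^-1 *: z); split.
    rewrite dotZl dotZr mulrA -invfM -expr2 sqr_sqrtr ?dot_ge0 // mulVf //.
    by rewrite gt_eqF // dot_gt0.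
  by rewrite -scalemxAr Mz scalerA mulrC -scalerA.
have [x0|x0] := eqVneq x 0; last by apply: (norm x x0); rewrite Mx a20 scale0r subr0.
apply: (norm y); last by rewrite My a20 scale0r addr0.
by apply/eqP => y0; move: nz; rewrite x0 y0 !dot0l addr0 ltxx.
Qed.

(** The reflection that exchanges v and the first basis vector. *)
Lemma householder n (v : 'cV[R]_n.+1) : dot v v = 1 ->
  exists H : 'M[R]_n.+1, [/\ H^T = H, H *m H = 1%:M & H *m delta_mx 0 0 = v].
Proof.
move=> vv; pose e : 'cV[R]_n.+1 := delta_mx 0 0.
have [ve|ve] := eqVneq v e.
  by exists 1%:M; rewrite trmx1 !mul1mx ve.
have [w wE] : exists w, w = v - e by exists (v - e).
have w0 : dot w w != 0.
  by apply/eqP => /dot_eq0 /eqP; rewrite wE subr_eq0; apply/negP.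
have ee : dot e e = 1.
  rewrite /dot (bigD1 0) //= big1 ?addr0 ?mxE ?eqxx ?mulr1 //.
  by move=> i /negPf i0; rewrite !mxE i0 /= mul0r.
have we : 2 * dot w e = - dot w w.
  rewrite wE !(dotDl, dotDr, dotNl, dotNr) ee vv (dotC e v); ring.
exists (1%:M - (2 / dot w w) *: (w *m w^T)); split.
- by rewrite linearB /= trmx1 linearZ /= trmx_mul trmxK.
- set X := w *m w^T; have XX : X *m X = dot w w *: X.
    by rewrite /X mulmxA -(mulmxA w) dotE mul_mx_scalar -scalemxAl.
  rewrite mulmxBr mulmx1 mulmxBl mul1mx -scalemxAl -scalemxAr XX !scalerA.
  have -> : 2 / dot w w * (2 / dot w w) * dot w w = 2 / dot w w + 2 / dot w w.
    by field.
  by rewrite scalerDl opprB addrK subrK.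
- rewrite mulmxBl mul1mx -scalemxAl -mulmxA dotE mul_mx_scalar scalerA.
  have -> : 2 / dot w w * dot w e = -1 by rewrite mulrAC we mulNr divff.
  by rewrite scaleN1r opprK wE addrC subrK.
Qed.

(** Conjugation by the reflection that maps the first basis vector to a unit
    eigenvector splits off a 1 x 1 block, and the other block is symmetric. *)
Lemma symm_diag n (M : 'M[R]_n) : M^T = M ->
  exists (P : 'M[R]_n) (d : 'rV[R]_n),
    P^T *m P = 1%:M /\ M = P *m diag_mx d *m P^T.
Proof.
elim: n M => [|n IH] M sM.
  by exists 0, 0; split; apply/matrixP => -[].
have [a [v [vv Mv]]] := symm_eigenvector sM.
have [H [sH HH He]] := householder vv.
pose e : 'cV[R]_n.+1 := delta_mx 0 0.
pose N : 'M[R]_(1 + n) := H *m M *m H.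
have sN : N^T = N by rewrite /N !trmx_mul sH sM mulmxA.
have Ne : N *m e = a *: e.
  have -> : N *m e = H *m (M *m (H *m e)) by rewrite /N !mulmxA.
  by rewrite He Mv -scalemxAr -He mulmxA HH mul1mx.
have N0 i : N i 0 = a * (i == 0)%:R.
  have /colP/(_ i) := Ne; rewrite -colE !mxE eqxx andbT => //.
have l0 : lshift n (0 : 'I_1) = 0 :> 'I_(1 + n) by apply/val_inj.
have dl : dlsubmx N = 0.
  apply/colP => i; rewrite [LHS]mxE [LHS]mxE l0 N0 [RHS]mxE.
  by rewrite (_ : _ == _ = false) ?mulr0.
have ul : ulsubmx N = a%:M.
  by apply/matrixP => i j; rewrite !ord1 [LHS]mxE [LHS]mxE l0 N0 mxE eqxx mulr1 mulr1n.
have ur : ursubmx N = 0 by rewrite -[LHS]trmxK trmx_ursub sN dl trmx0.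
have [|P [d [PP drE]]] := IH (drsubmx N).
  by rewrite trmx_drsub sN.
pose B : 'M[R]_(1 + n) := block_mx 1%:M 0 0 P.
pose D : 'rV[R]_(1 + n) := row_mx a%:M d.
have BB : B^T *m B = 1%:M.
  rewrite /B tr_block_mx mulmx_block.
  rewrite !trmx0 trmx1 !mulmx0 !mul0mx !addr0 add0r mul1mx.
  by rewrite PP -scalar_mx_block.
have NE : N = B *m diag_mx D *m B^T.
  rewrite -[LHS]submxK dl ul ur drE /B /D tr_block_mx diag_mx_row !mulmx_block.
  rewrite !trmx0 trmx1 !mulmx0 !mul0mx !addr0 !add0r mul1mx mulmx1.
  congr block_mx; rewrite ?mul0mx //.
  by apply/matrixP => i j; rewrite !ord1 !mxE.
exists (H *m B), D; split.
  by rewrite trmx_mul sH -mulmxA (mulmxA H) HH mul1mx BB.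
have -> : M = H *m N *m H.
  by rewrite /N !mulmxA HH mul1mx -mulmxA HH mulmx1.
by rewrite NE trmx_mul sH !mulmxA.
Qed.

Lemma char_poly_diag n (P : 'M[R]_n) (d : 'rV[R]_n) : P^T *m P = 1%:M ->
  char_poly (P *m diag_mx d *m P^T) = \prod_i ('X - (d 0 i)%:P).
Proof.
move=> PP; have PP' : P *m P^T = 1%:M by apply: mulmx1C.
have -> : char_poly (P *m diag_mx d *m P^T) = char_poly (diag_mx d).
  rewrite /char_poly /char_poly_mx !map_mxM /=.
  set p := map_mx polyC P; set q := map_mx polyC P^T.
  have pq : p *m q = 1%:M by rewrite -map_mxM PP' map_mx1.
  have -> : 'X%:M - p *m map_mx polyC (diag_mx d) *m q =
            p *m ('X%:M - map_mx polyC (diag_mx d)) *m q.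
    by rewrite mulmxBr mulmxBl mul_mx_scalar -scalemxAl pq scalemx1.
  by rewrite !det_mulmx mulrAC -det_mulmx pq det1 mul1r.
rewrite char_poly_trig; last exact: diag_mx_is_trig.
by apply: eq_bigr => i _; rewrite mxE eqxx.
Qed.

Variables (n : nat) (M : 'M[R]_n).
Hypothesis sM : M^T = M.

(** The diagonalization shows that the characteristic polynomial splits, and
    unique factorization identifies the sorted list of its roots with the
    diagonal up to order. *)
Lemma eigenvalues_symP :
  exists (P : 'M[R]_n) (d : 'rV[R]_n),
  [/\ P^T *m P = 1%:M, M = P *m diag_mx d *m P^T, sorted <=%R (eigenvalues M)
    & perm_eq (eigenvalues M) [tuple d 0 i | i < n]].
Proof.
have [P [d [PP ME]]] := symm_diag sM; exists P, d.
pose s := sort <=%R [tuple d 0 i | i < n].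
have cE : char_poly M = \prod_(x <- [tuple d 0 i | i < n]) ('X - x%:P).
  by rewrite ME char_poly_diag // big_tuple; apply: eq_bigr => i _; rewrite tnth_mktuple.
have [|] := @xgetPex _ [::] [set s : seq R | sorted <=%R s
                           /\ char_poly M = \prod_(x <- s) ('X - x%:P)]%classic.
  exists s; split; first exact/sort_sorted/le_total.
  by rewrite cE; apply: perm_big; rewrite perm_sym perm_sort.
rewrite -/(eigenvalues M) => so e; split=> //.
by apply: prod_XsubC_eq; rewrite -e.
Qed.

Lemma lambda_mono i j : (i <= j < n)%N -> lambda M i <= lambda M j.
Proof.
have [P [d [_ _ so pe]]] := eigenvalues_symP; move=> /andP[ij jn].
have sz : size (eigenvalues M) = n by rewrite (perm_size pe) size_tuple.
by apply: (sorted_leq_nth le_trans le_refl) => //; rewrite inE sz // (leq_ltn_trans ij).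
Qed.

Lemma symm_eigenbasis : exists u, orthonormal_eigenbasis M u.
Proof.
have [P [d [PP ME so pe]]] := eigenvalues_symP.
have sz : size (eigenvalues M) == n by rewrite (perm_size pe) size_tuple.
have [p pE] := tuple_permP pe.
have pE' (k : 'I_n) : lambda M k = d 0 (p k).
  rewrite /lambda pE.
  by rewrite nth_mktuple tnth_mktuple.
exists (fun k => if insub k is Some i then col (p i) P else 0).
have colE i : col i P = P *m delta_mx i 0 by rewrite colE.
split=> [j k jn kn|k kn].
  rewrite !insubT !colE trmx_mul -mulmxA (mulmxA P^T) PP mul1mx.
  rewrite trmx_delta mul_delta_mx_cond; apply/matrixP => a b.
  rewrite !ord1 !mxE mulr1n (inj_eq perm_inj) -val_eqE /=.
  by case: (j == k); rewrite ?mxE.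
rewrite insubT /= {1}ME colE -!mulmxA (mulmxA P^T) PP mul1mx mul_diag_mx.
rewrite scalemxAr; congr (_ *m _); apply/colP => i; rewrite !mxE eqxx andbT.
have [->|_] := eqVneq i; last by rewrite !mulr0.
by rewrite -(pE' (Sub k kn)).
Qed.

End Spectral.

(** * Rayleigh quotients *)

Section Rayleigh.
Variables (R : realType) (n : nat) (M : 'M[R]_n) (u : nat -> 'cV[R]_n).
Hypotheses (sM : M^T = M) (uP : orthonormal_eigenbasis M u).
Implicit Types x : 'cV[R]_n.

Lemma basis_dot j k : (j < n)%N -> (k < n)%N -> dot (u j) (u k) = (j == k)%:R.
Proof.
case: uP => h _ jn kn; have := h j k jn kn.
by rewrite dotE => /matrixP/(_ 0 0); rewrite !mxE !mulr1n.
Qed.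

Lemma basis_eigen k : (k < n)%N -> M *m u k = lambda M k *: u k.
Proof. by case: uP => _ h; exact: h. Qed.

Lemma basis_expand x : x = \sum_(k < n) dot x (u k) *: u k.
Proof.
pose U : 'M[R]_n := \matrix_(i, j) u j i 0.
have UU : U^T *m U = 1%:M.
  apply/matrixP => i j; rewrite !mxE -(basis_dot (ltn_ord i) (ltn_ord j)).
  by apply: eq_bigr => k _; rewrite !mxE.
have {UU} UU : U *m U^T = 1%:M by apply: mulmx1C.
rewrite -[LHS]mul1mx -UU -mulmxA; apply/colP => i; rewrite !mxE summxE.
apply: eq_bigr => k _; rewrite !mxE mulrC; congr (_ * _).
by apply: eq_bigr => j _; rewrite !mxE mulrC.
Qed.

Lemma parseval x : dot x x = \sum_(k < n) dot x (u k) ^+ 2.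
Proof.
rewrite {1}(basis_expand x) dot_suml; apply: eq_bigr => k _.
by rewrite dotZl (dotC _ x) expr2.
Qed.

Lemma form_expand x : dot x (M *m x) = \sum_(k < n) lambda M k * dot x (u k) ^+ 2.
Proof.
rewrite {1}(basis_expand x) dot_suml; apply: eq_bigr => k _.
by rewrite dotZl dot_sym // basis_eigen // dotZl (dotC _ x) mulrCA expr2.
Qed.

Lemma rayleigh_ge k x : (forall j, (j < k)%N -> (j < n)%N -> dot x (u j) = 0) ->
  lambda M k * dot x x <= dot x (M *m x).
Proof.
move=> h; rewrite form_expand parseval mulr_sumr; apply: ler_sum => i _.
have [ik|ki] := ltnP i k; first by rewrite h // expr0n /= !mulr0.
by rewrite ler_wpM2r ?sqr_ge0 // lambda_mono // ki ltn_ord.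
Qed.

(** Courant-Fischer, upper half: such a test vector only has components on the
    eigenvalues of index at least k. *)
Lemma lambda_le k a x : x != 0 ->
  (forall j, (j < k)%N -> (j < n)%N -> dot x (u j) = 0) ->
  dot x (M *m x) <= a * dot x x -> lambda M k <= a.
Proof.
move=> x0 /rayleigh_ge h1 h2.
by rewrite -(ler_pM2r (dot_gt0 x0)); apply: le_trans h1 h2.
Qed.

Lemma basis_comb_dot k (t : 'I_k -> R) j : (k <= n)%N -> (j < n)%N ->
  dot (\sum_(i < k) t i *: u i) (u j) = if insub j is Some i then t i else 0.
Proof.
move=> kn jn; rewrite dot_suml.
under eq_bigr => i _ do rewrite dotZl (basis_dot (leq_trans (ltn_ord i) kn) jn).
case: insubP => [i _ <-|].
  rewrite (bigD1 i) //= eqxx mulr1 big1 ?addr0 // => l li.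
  by rewrite val_eqE (negPf li) mulr0.
by move=> jk; rewrite big1 // => i _; case: eqP => [e|]; [rewrite -e ltn_ord in jk|rewrite mulr0].
Qed.

Lemma basis_comb_neq0 k (t : 'I_k -> R) : (k <= n)%N -> (exists i, t i != 0) ->
  \sum_(i < k) t i *: u i != 0.
Proof.
move=> kn [i ti]; apply: contra ti => /eqP h.
have := basis_comb_dot t kn (leq_trans (ltn_ord i) kn).
by rewrite h dot0l valK => <-.
Qed.

Lemma rayleigh_le k (t : 'I_k.+1 -> R) : (k < n)%N ->
  let x := \sum_(i < k.+1) t i *: u i in
  dot x (M *m x) <= lambda M k * dot x x.
Proof.
move=> kn /=; rewrite form_expand parseval mulr_sumr; apply: ler_sum => i _.
rewrite basis_comb_dot //; case: insubP => [j _ ji|_]; last by rewrite expr0n /= !mulr0.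
rewrite ler_wpM2r ?sqr_ge0 // lambda_mono // kn andbT.
by have := ltn_ord j; rewrite ltnS; move: ji => /= ->.
Qed.

(** Courant-Fischer, lower half: the span of u_0, ..., u_k meets every subspace
    of codimension k, and there the form is at most lambda_k. *)
Lemma lambda_ge k a (z : 'I_k -> 'cV[R]_n) : (k < n)%N ->
  (forall x, (forall j, dot x (z j) = 0) -> a * dot x x <= dot x (M *m x)) ->
  a <= lambda M k.
Proof.
move=> kn h; have [t t0 tz] := nonzero_comb (fun i : 'I_k.+1 => u i) z (ltnSn k).
have x0 := basis_comb_neq0 kn t0.
by rewrite -(ler_pM2r (dot_gt0 x0)); apply: le_trans (h _ tz) (rayleigh_le t kn).
Qed.

End Rayleigh.

(** * Trigonometric estimates *)

Section Trig.
Variable R : realType.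
Implicit Types x y : R.

Lemma sin_mvt x y : x <= y ->
  exists2 z, x <= z <= y & sin y - sin x = cos z * (y - x).
Proof.
move=> xy; have h1 z : z \in `]x, y[ -> is_derive z 1 (@sin R) (cos z).
  by move=> _; exact: is_derive_sin.
have h2 : {within `[x, y], continuous (@sin R)}%classic.
  by apply: continuous_subspaceT => w; exact: continuous_sin.
have [z] := MVT_segment xy h1 h2.
by rewrite in_itv /= => zi e; exists z.
Qed.

Lemma cos_mvt x y : x <= y ->
  exists2 z, x <= z <= y & cos y - cos x = - sin z * (y - x).
Proof.
move=> xy; have h1 z : z \in `]x, y[ -> is_derive z 1 (@cos R) (- sin z).
  by move=> _; exact: is_derive_cos.
have h2 : {within `[x, y], continuous (@cos R)}%classic.
  by apply: continuous_subspaceT => w; exact: continuous_cos.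
have [z] := MVT_segment xy h1 h2.
by rewrite in_itv /= => zi e; exists z.
Qed.

Lemma sin_lip x y : `|sin x - sin y| <= `|x - y|.
Proof.
wlog xy : x y / x <= y.
  move=> h; have [/h //|/ltW /h] := leP x y.
  by rewrite distrC [leRHS]distrC.
have [z _ e] := sin_mvt xy; rewrite distrC [leRHS]distrC e normrM.
by rewrite ler_piMl // cos_max.
Qed.

Lemma cos_lip x y : `|cos x - cos y| <= `|x - y|.
Proof.
wlog xy : x y / x <= y.
  move=> h; have [/h //|/ltW /h] := leP x y.
  by rewrite distrC [leRHS]distrC.
have [z _ e] := cos_mvt xy; rewrite distrC [leRHS]distrC e normrM normrN.
by rewrite ler_piMl // sin_max.
Qed.

Lemma abs_sin_le x : `|sin x| <= `|x|.
Proof. by have := sin_lip x 0; rewrite sin0 !subr0. Qed.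

Lemma pi_le4 : pi <= 4 :> R.
Proof. by have := pihalf_lt2 R; lra. Qed.

Lemma cos_double x : cos x = 1 - 2 * sin (x / 2) ^+ 2.
Proof.
rewrite [in LHS](_ : x = (x / 2) *+ 2); last by rewrite -mulr_natl; field.
by rewrite cos_mulr2n cos2sin2; ring.
Qed.

Lemma sin_double x : sin x = 2 * (sin (x / 2) * cos (x / 2)).
Proof.
rewrite [in LHS](_ : x = (x / 2) *+ 2); last by rewrite -mulr_natl; field.
by rewrite sin_mulr2n -mulr_natl; ring.
Qed.

(** Squared chord length on the unit circle. *)
Lemma chord_sqr x y :
  (cos x - cos y) ^+ 2 + (sin x - sin y) ^+ 2 = 4 * sin ((x - y) / 2) ^+ 2.
Proof.
have := cos_double (x - y); rewrite cosB => h.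
have := cos2Dsin2 x; have := cos2Dsin2 y; lra.
Qed.

Lemma chord_le x y : (cos x - cos y) ^+ 2 + (sin x - sin y) ^+ 2 <= (x - y) ^+ 2.
Proof.
rewrite chord_sqr; have := abs_sin_le ((x - y) / 2).
rewrite -ler_sqr ?nnegrE // !real_normK ?num_real // => h; lra.
Qed.

(** A weak Jordan inequality, by sin x = 2 sin (x/2) cos (x/2) and the mean
    value theorem, as cos >= 1/sqrt 2 on [0, pi/4]. *)
Lemma jordan x : 0 <= x <= pi / 2 -> x / 2 <= sin x.
Proof.
move=> /andP[x0 xpi]; have h0 : 0 <= x / 2 by lra.
have [z /andP[z0 zx]] := sin_mvt h0; rewrite sin0 !subr0 => e.
have cx : 0 <= cos x by apply: cos_ge0_pihalf; have := pi_gt0 R; lra.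
have c2 : 1 / 2 <= cos (x / 2) ^+ 2.
  have := cos_double x; rewrite sin2cos2; lra.
have cz : cos (x / 2) <= cos z.
  move: zx; rewrite le_eqVlt => /orP[/eqP -> //|zx]; apply: ltW.
  by rewrite ltr_cos ?in_itv //=; have := pi_gt0 R; lra.
have c0 : 0 <= cos (x / 2) by apply: cos_ge0_pihalf; have := pi_gt0 R; lra.
rewrite sin_double e.
have : cos (x / 2) ^+ 2 <= cos z * cos (x / 2) by rewrite expr2 ler_wpM2r.
move=> h; have : 1 / 2 * x <= cos z * cos (x / 2) * x by rewrite ler_wpM2r //; lra.
by move=> h3; apply: le_trans (_ : cos z * cos (x / 2) * x <= _); [lra|rewrite le_eqVlt; apply/orP; left; apply/eqP; field].
Qed.

(** 2 pi is the only zero of sin (x / 2) on this interval; Jordan's inequality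
    applies to x / 2 on the left of pi and to x / 2 - pi on the right. *)
Lemma near_period x : 1 <= x <= 3 * pi -> `|x - 2 * pi| <= 32 * `|sin (x / 2)|.
Proof.
move=> /andP[x1 x3]; have p0 := pi_gt0 R; have p4 := pi_le4; have p2 := pi_ge2 R.
have [xpi|xpi] := leP x pi.
  have h : x / 2 / 2 <= sin (x / 2) by apply: jordan; lra.
  have : sin (x / 2) <= `|sin (x / 2)| by exact: ler_norm.
  have : `|x - 2 * pi| <= 8 by rewrite ler_norml; lra.
  by lra.
have e : sin (x / 2) = - sin (x / 2 - pi) by rewrite -[x / 2 in LHS](subrK pi) sinDpi.
rewrite e normrN; set y := x / 2 - pi.
have -> : `|x - 2 * pi| = 2 * `|y|.
  by rewrite -[2 in RHS]ger0_norm // -normrM; congr `|_|; rewrite /y; field.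
have [y0|y0] := leP 0 y.
  have h : y / 2 <= sin y by apply: jordan; rewrite /y; rewrite /y in y0; lra.
  rewrite (ger0_norm y0); have := ler_norm (sin y); lra.
have h : - y / 2 <= sin (- y) by apply: jordan; rewrite /y; rewrite /y in y0; lra.
rewrite (ltr0_norm y0); move: h; rewrite sinN => h.
have := ler_norm (- sin y); rewrite normrN; lra.
Qed.

(** The factor 2 sin (t / 2) makes the sum telescope. *)
Lemma sum_cos_tel (t : R) n : 2 * sin (t / 2) * (\sum_(i < n) cos (i%:R * t)) =
   sin ((n%:R - 1 / 2) * t) + sin (t / 2).
Proof.
elim: n => [|n IH].
  rewrite big_ord0 mulr0 (_ : _ * t = - (t / 2)) ?sinN ?addNr //; by field.
rewrite big_ord_recr mulrDr IH /=.
have -> : (n%:R - 1 / 2) * t = n%:R * t - t / 2 by field.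
have -> : (n.+1%:R - 1 / 2) * t = n%:R * t + t / 2 by rewrite -natr1; field.
by rewrite sinB sinD; ring.
Qed.

Lemma sum_sin_tel (t : R) n : 2 * sin (t / 2) * (\sum_(i < n) sin (i%:R * t)) =
   cos (t / 2) - cos ((n%:R - 1 / 2) * t).
Proof.
elim: n => [|n IH].
  rewrite big_ord0 mulr0 (_ : (_ - _) * t = - (t / 2)) ?cosN ?subrr //; by field.
rewrite big_ord_recr mulrDr IH /=.
have -> : (n%:R - 1 / 2) * t = n%:R * t - t / 2 by field.
have -> : (n.+1%:R - 1 / 2) * t = n%:R * t + t / 2 by rewrite -natr1; field.
by rewrite cosB cosD; ring.
Qed.

Lemma cos_2pik (k : nat) y : cos (k%:R * (2 * pi) - y) = cos y.
Proof.
rewrite addrC (_ : k%:R * (2 * pi) = (pi *+ 2) *+ k); last first.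
  by rewrite -[RHS]mulr_natl -[pi *+ 2]mulr_natl.
by rewrite (periodicn (@cosD2pi R)) cosN.
Qed.

Lemma sin_2pik (k : nat) y : sin (k%:R * (2 * pi) - y) = - sin y.
Proof.
rewrite addrC (_ : k%:R * (2 * pi) = (pi *+ 2) *+ k); last first.
  by rewrite -[RHS]mulr_natl -[pi *+ 2]mulr_natl.
by rewrite (periodicn (@sinD2pi R)) sinN.
Qed.

Variable n : nat.
Hypothesis n3 : (3 <= n)%N.

Definition ang (i : nat) : R := 2 * pi * i%:R / n%:R.

Lemma sum_roots k : (0 < k)%N -> (k < n)%N ->
  (\sum_(i < n) cos (k%:R * ang i) = 0) /\ (\sum_(i < n) sin (k%:R * ang i) = 0).
Proof.
move=> k0 kn; have n0 : 0 < n%:R :> R by rewrite ltr0n; case: (n) n3.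
pose t := k%:R * (2 * pi) / n%:R : R.
have te i : k%:R * ang i = i%:R * t.
  by rewrite /ang /t; field; rewrite gt_eqF.
have st : 2 * sin (t / 2) != 0.
  rewrite mulf_neq0 // gt_eqF // sin_gt0_pi //.
  have -> : t / 2 = (k%:R / n%:R) * pi by rewrite /t; field; rewrite gt_eqF.
  rewrite mulr_gt0 ?pi_gt0 ?divr_gt0 ?(ltr0n _ k) //=.
  by rewrite gtr_pMl ?pi_gt0 // ltr_pdivrMr // mul1r ltr_nat.
have nt : (n%:R - 1 / 2) * t = k%:R * (2 * pi) - t / 2.
  by rewrite /t; field; rewrite gt_eqF.
split; apply/(mulfI st); rewrite mulr0 (eq_bigr _ (fun (i : 'I_n) _ => congr1 _ (te i))).
  by rewrite sum_cos_tel nt sin_2pik addNr.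
by rewrite sum_sin_tel nt cos_2pik subrr.
Qed.

(** Discrete orthogonality of cos and sin on the n-th roots of unity. The doubled
    angle occurs, hence the condition that n is at least 3. *)
Lemma sum_profile x y x' y' :
  \sum_(i < n) (x * cos (ang i) + y * sin (ang i)) * (x' * cos (ang i) + y' * sin (ang i))
  = n%:R / 2 * (x * x' + y * y').
Proof.
have [c2 s2] : (\sum_(i < n) cos (2 * ang i) = 0) /\ (\sum_(i < n) sin (2 * ang i) = 0).
  by have := @sum_roots 2 isT n3.
transitivity (\sum_(i < n) ((x * x' + y * y') / 2 + (x * x' - y * y') / 2 * cos (2 * ang i)
   + (x * y' + y * x') / 2 * sin (2 * ang i))).
  apply: eq_bigr => i _; rewrite (cos_double (2 * _)) (sin_double (2 * _)).
  have -> : 2 * ang i / 2 = ang i by field.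
  have := cos2Dsin2 (ang i); set c := cos _; set s := sin _ => e.
  have -> : (x * c + y * s) * (x' * c + y' * s) =
    x * x' * c ^+ 2 + (x * y' + y * x') * (s * c) + y * y' * s ^+ 2 by ring.
  have -> : c ^+ 2 = 1 - s ^+ 2 by lra.
  by field.
rewrite !big_split /= -!mulr_sumr c2 s2 !mulr0 !addr0 sumr_const card_ord -mulr_natl.
by field.
Qed.

Lemma sum_profile1 x y : \sum_(i < n) (x * cos (ang i) + y * sin (ang i)) = 0.
Proof.
have [c1 s1] : (\sum_(i < n) cos (1 * ang i) = 0) /\ (\sum_(i < n) sin (1 * ang i) = 0).
  by have := @sum_roots 1 isT (ltnW n3).
rewrite big_split /= -!mulr_sumr.
move: c1 s1; under eq_bigr do rewrite mul1r; move=> ->.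
by under eq_bigr do rewrite mul1r; move=> ->; rewrite !mulr0 addr0.
Qed.

End Trig.

(** * Perturbed rotations *)

Lemma norm_lin3 (R : realType) (x y z p q r P Q S : R) :
  `|x| <= P -> `|y| <= Q -> `|z| <= S ->
  `|x * p + y * q + z * r| <= P * `|p| + Q * `|q| + S * `|r|.
Proof.
move=> hx hy hz; apply: le_trans (ler_normD _ _) _; apply: lerD.
  by apply: le_trans (ler_normD _ _) _; apply: lerD; rewrite normrM ler_wpM2r.
by rewrite normrM ler_wpM2r.
Qed.

(** The dimensionless form of the eigenvector equation: u is the potential, b the
    scaled flux, eps the scaled deviation of the resistance positions from the
    uniform ones, and a the potential corrected by eps b. The numeric constants
    below are crude absolute ones. *)
Section Shooting.
Variables (R : realType) (n : nat) (om E del : R) (a b u eps : nat -> R).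
Hypotheses (n0 : (0 < n)%N) (om1 : 1 <= om * n%:R) (om3 : om * n%:R <= 3 * pi).
Hypotheses (nd : 1 <= del * n%:R) (Ed : E <= 12 * del) (del1 : del <= 1 / 64 / 90).
Hypotheses (epsE : forall i, `|eps i| <= E) (uE : forall i, u i = a i + eps i * b i).
Hypothesis bS : forall i, b i.+1 = b i - om * u i.
Hypothesis aS : forall i, a i.+1 = a i + om * b i.+1 + om * eps i * u i.
Hypotheses (an : a n = a 0%N) (bn : b n = b 0%N) (ab0 : 0 < `|a 0%N| + `|b 0%N|).

Let n0' : 0 < n%:R :> R. Proof. by rewrite ltr0n. Qed.
Let om0 : 0 < om.
Proof. by rewrite -(pmulr_lgt0 _ n0'); apply: lt_le_trans om1. Qed.
Let om12 : om * n%:R <= 12.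
Proof. by apply: le_trans om3 _; have := pi_le4 R; lra. Qed.
Let omd : om <= 12 * del.
Proof.
have : om * n%:R <= 12 * del * n%:R by apply: le_trans om12 _; have := nd; lra.
by rewrite ler_pM2r.
Qed.
Let E0 : 0 <= E. Proof. exact: le_trans (normr_ge0 _) (epsE 0%N). Qed.
Let d0 : 0 < del.
Proof. by rewrite -(pmulr_lgt0 _ n0'); apply: lt_le_trans nd. Qed.

Ltac ctx := have ? := nd; have ? := Ed; have ? := del1; have ? := d0; have ? := E0;
  have ? := om12; have ? := omd; have ? := om0; have ? := om1; have ? := ab0.

Let N i := `|a i| + `|b i|.

Let Ea i := a i.+1 - (a i * cos om + b i * sin om).
Let Eb i := b i.+1 - (- a i * sin om + b i * cos om).

Let cos_om : `|1 - cos om| <= om ^+ 2.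
Proof.
ctx; have := abs_sin_le (om / 2); rewrite -ler_sqr ?nnegrE // !real_normK ?num_real // => h.
have h2 := sqr_ge0 (sin (om / 2)).
rewrite cos_double ler_norml; have := sqr_ge0 om; lra.
Qed.

Let sin_om : `|om - sin om| <= om ^+ 2.
Proof.
ctx; have [z /andP[z0 zo]] := sin_mvt (ltW om0); rewrite sin0 !subr0 => ->.
have := cos_lip 0 z; rewrite cos0 sub0r normrN (ger0_norm z0) => h.
have -> : om - cos z * om = (1 - cos z) * om by ring.
rewrite normrM (gtr0_norm om0) expr2 ler_wpM2r ?(ltW om0) //.
by apply: le_trans h zo.
Qed.

Let uN i : `|u i| <= N i.
Proof.
ctx; rewrite uE /N; apply: le_trans (ler_normD _ _) _; rewrite lerD2l normrM.
by rewrite ler_piMl //; apply: le_trans (epsE i) _; lra.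
Qed.

(** One step is the rotation by om up to this error, which after n steps adds up
    to O(del). *)
Let step_err i : `|Ea i| + `|Eb i| <= 60 * del * om * N i.
Proof.
ctx; have ea : `|Ea i| <= om ^+ 2 * `|a i| + om ^+ 2 * `|b i| + (om ^+ 2 + om * E) * `|u i|.
  have -> : Ea i = (1 - cos om) * a i + (om - sin om) * b i + (- om ^+ 2 + om * eps i) * u i.
    by rewrite /Ea aS bS; ring.
  apply: norm_lin3 => //; apply: le_trans (ler_normD _ _) _.
  rewrite normrN normrX normrM (gtr0_norm om0); apply: lerD => //.
  by rewrite ler_wpM2l // ltW.
have eb : `|Eb i| <= om ^+ 2 * `|b i| + om ^+ 2 * `|a i| + (om * E) * `|b i|.
  have -> : Eb i = (1 - cos om) * b i + (- (om - sin om)) * a i + (- (om * eps i)) * b i.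
    by rewrite /Eb bS uE; ring.
  apply: norm_lin3 => //; rewrite normrN // normrM (gtr0_norm om0).
  by rewrite ler_wpM2l // ltW.
have a0 := normr_ge0 (a i); have b0 := normr_ge0 (b i).
have N0 : 0 <= N i by rewrite /N addr_ge0.
have hu := uN i.
have oo : om ^+ 2 <= 12 * del * om by rewrite expr2 ler_wpM2r // ltW.
have oE : om * E <= 12 * del * om by rewrite mulrC ler_wpM2r // ltW.
have oo0 := sqr_ge0 om.
have oE0 : 0 <= om * E by rewrite mulr_ge0 // ltW.
have h1 : (om ^+ 2 + om * E) * `|u i| <= (om ^+ 2 + om * E) * N i.
  by rewrite ler_wpM2l // addr_ge0.
have h2 : (om * E) * `|b i| <= (om * E) * N i.
  by rewrite ler_wpM2l // /N lerDr.
have h3 : om ^+ 2 * N i <= 12 * del * om * N i by rewrite ler_wpM2r.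
have h4 : om * E * N i <= 12 * del * om * N i by rewrite ler_wpM2r.
have hN : om ^+ 2 * N i = om ^+ 2 * `|a i| + om ^+ 2 * `|b i| by rewrite /N mulrDr.
lra.
Qed.

Let th i := i%:R * om.
Let A i := cos (th i) * a i - sin (th i) * b i.
Let B i := sin (th i) * a i + cos (th i) * b i.
Let V i := `|A i - a 0%N| + `|B i - b 0%N|.
Let M := `|a 0%N| + `|b 0%N|.

Let rot2 (c s x y : R) : c ^+ 2 + s ^+ 2 = 1 ->
  `|c * x - s * y| + `|s * x + c * y| <= 2 * (`|x| + `|y|).
Proof.
ctx; move=> cs; have c1 : `|c| <= 1.
  by rewrite -ler_sqr ?nnegrE // real_normK ?num_real // expr1n; have := sqr_ge0 s; lra.
have s1 : `|s| <= 1.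
  by rewrite -ler_sqr ?nnegrE // real_normK ?num_real // expr1n; have := sqr_ge0 c; lra.
have h1 : `|c * x - s * y| <= `|x| + `|y|.
  by apply: le_trans (ler_normB _ _) _; rewrite !normrM lerD // ler_piMl.
have h2 : `|s * x + c * y| <= `|x| + `|y|.
  by apply: le_trans (ler_normD _ _) _; rewrite !normrM lerD // ler_piMl.
lra.
Qed.

(** In the frame rotating with the angle om the state only moves by the errors. *)
Let VS i : V i.+1 <= V i + 2 * (60 * del * om * N i).
Proof.
ctx; have thS : th i.+1 = th i + om by rewrite /th -natr1; ring.
have hA : A i.+1 - a 0%N = (A i - a 0%N) + (cos (th i.+1) * Ea i - sin (th i.+1) * Eb i).
  have cs := cos2Dsin2 om.
  rewrite /A /Ea /Eb thS cosD sinD.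
  set x := a i.+1; set y := b i.+1; set c := cos (th i); set s := sin (th i).
  set c' := cos om in cs *; set s' := sin om in cs *.
  have -> : c * a i - s * b i = (c' ^+ 2 + s' ^+ 2) * (c * a i - s * b i) by rewrite cs mul1r.
  by ring.
have hB : B i.+1 - b 0%N = (B i - b 0%N) + (sin (th i.+1) * Ea i + cos (th i.+1) * Eb i).
  have cs := cos2Dsin2 om.
  rewrite /B /Ea /Eb thS cosD sinD.
  set x := a i.+1; set y := b i.+1; set c := cos (th i); set s := sin (th i).
  set c' := cos om in cs *; set s' := sin om in cs *.
  have -> : s * a i + c * b i = (c' ^+ 2 + s' ^+ 2) * (s * a i + c * b i) by rewrite cs mul1r.
  by ring.
have := rot2 (Ea i) (Eb i) (cos2Dsin2 (th i.+1)) => h.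
have e := step_err i.
have h1 := ler_normD (A i - a 0%N) (cos (th i.+1) * Ea i - sin (th i.+1) * Eb i).
have h2 := ler_normD (B i - b 0%N) (sin (th i.+1) * Ea i + cos (th i.+1) * Eb i).
rewrite /V hA hB; lra.
Qed.

Let aAB i : a i = A i * cos (th i) + B i * sin (th i).
Proof.
ctx; rewrite /A /B; have cs := cos2Dsin2 (th i).
by rewrite -[LHS]mul1r -cs; ring.
Qed.

Let bAB i : b i = - A i * sin (th i) + B i * cos (th i).
Proof.
ctx; rewrite /A /B; have cs := cos2Dsin2 (th i).
by rewrite -[LHS]mul1r -cs; ring.
Qed.

Let NV i : N i <= 2 * (V i + M).
Proof.
ctx; have h : `|cos (th i) * A i - - sin (th i) * B i| + `| - sin (th i) * A i + cos (th i) * B i|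
   <= 2 * (`|A i| + `|B i|).
  by apply: rot2; rewrite sqrrN cos2Dsin2.
have ea : a i = cos (th i) * A i - - sin (th i) * B i by rewrite {1}aAB; ring.
have eb : b i = - sin (th i) * A i + cos (th i) * B i by rewrite {1}bAB; ring.
rewrite /N ea eb.
apply: le_trans h _; rewrite ler_pM2l //.
have := ler_normD (A i - a 0%N) (a 0%N); have := ler_normD (B i - b 0%N) (b 0%N).
rewrite !subrK /V /M; lra.
Qed.

Let th12 i : (i <= n)%N -> th i <= 12.
Proof.
ctx; by move=> i_n; apply: le_trans om12; rewrite /th mulrC ler_pM2l // ler_nat.
Qed.

(** Bootstrap: while the drift stays below the initial size M, the size of the
    state is at most 4 M, which bounds the next increment of the drift. *)
Let V_le i : (i <= n)%N -> V i <= 8 * (60 * del) * th i * M.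
Proof.
ctx; elim: i => [_|i IH i_n].
  by rewrite /V /A /B /th mul0r cos0 sin0 !mul0r !mul1r subr0 add0r !subrr normr0; lra.
have {IH} IH := IH (ltnW i_n).
have M0 : 0 < M by [].
have t12 := th12 (ltnW i_n).
have VM : V i <= M.
  apply: le_trans IH _; rewrite -[leRHS]mul1r ler_wpM2r ?(ltW ab0) //.
  have : 8 * (60 * del) * th i <= 8 * (60 * del) * 12 by rewrite ler_wpM2l //; lra.
  lra.
have hN : N i <= 4 * M by have := NV i; lra.
have h : del * om * N i <= del * om * (4 * M).
  by rewrite ler_wpM2l // mulr_ge0 // ltW.
have := VS i; rewrite [th i.+1](_ : _ = th i + om); last by rewrite /th -natr1; ring.
move=> h2; have -> : 8 * (60 * del) * (th i + om) * M = 8 * (60 * del) * th i * M + 8 * (60 * del) * om * M by ring.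
lra.
Qed.

Let V_bd i : (i <= n)%N -> V i <= 64 * (90 * del) * M.
Proof.
move=> i_n; have ? := del1; have ? := d0; apply: le_trans (V_le i_n) _; have t12 := th12 i_n.
rewrite ler_wpM2r ?(ltW ab0) //.
have : 8 * (60 * del) * th i <= 8 * (60 * del) * 12 by rewrite ler_wpM2l //; lra.
lra.
Qed.

(** As the state returns to its initial value, the drift after n steps is the
    displacement of the initial vector under the rotation by om n, whose length
    has the factor 2 |sin (om n / 2)|. *)
Lemma shooting_period : `|om * n%:R - 2 * pi| <= 32 * (64 * (90 * del)).
Proof.
have ? := d0; have h1 : 1 <= om * n%:R <= 3 * pi by apply/andP; split.
have h2 := near_period h1.
apply: (le_trans h2) => {h1 h2}.
rewrite ler_pM2l //; set s := sin _.
have hV := V_bd (leqnn n).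
have e : (A n - a 0%N) ^+ 2 + (B n - b 0%N) ^+ 2 = 4 * s ^+ 2 * (a 0%N ^+ 2 + b 0%N ^+ 2).
  have := cos_double (om * n%:R); have := cos2Dsin2 (om * n%:R); rewrite -/s.
  rewrite /A /B an bn /th (mulrC n%:R); set c := cos _; set s' := sin _ => cs h.
  have -> : (c * a 0%N - s' * b 0%N - a 0%N) ^+ 2 + (s' * a 0%N + c * b 0%N - b 0%N) ^+ 2 =
     ((c ^+ 2 + s' ^+ 2) + 1 - 2 * c) * (a 0%N ^+ 2 + b 0%N ^+ 2) by ring.
  by rewrite cs h; congr (_ * _); ring.
have V2 : (A n - a 0%N) ^+ 2 + (B n - b 0%N) ^+ 2 <= V n ^+ 2.
  rewrite /V [leRHS]sqrrD !real_normK ?num_real //.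
  by have := mulr_ge0 (normr_ge0 (A n - a 0%N)) (normr_ge0 (B n - b 0%N)); rewrite mulr2n; lra.
have V0 : 0 <= V n by rewrite addr_ge0.
have M2 : M ^+ 2 <= 2 * (a 0%N ^+ 2 + b 0%N ^+ 2).
  have := sqr_ge0 (`|a 0%N| - `|b 0%N|); rewrite /M sqrrB sqrrD !real_normK ?num_real // mulr2n; lra.
have M0 : 0 < M ^+ 2 by rewrite exprn_gt0.
have VM : V n ^+ 2 <= (64 * (90 * del) * M) ^+ 2 by rewrite ler_sqr ?nnegrE // (le_trans V0).
rewrite -ler_sqr ?nnegrE //; last by lra.
rewrite real_normK ?num_real //.
have r0 : 0 < a 0%N ^+ 2 + b 0%N ^+ 2 by lra.
rewrite -(ler_pM2r r0).
have : (64 * (90 * del) * M) ^+ 2 <= 2 * ((64 * (90 * del)) ^+ 2 * (a 0%N ^+ 2 + b 0%N ^+ 2)).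
  rewrite exprMn [leRHS](_ : _ = (64 * (90 * del)) ^+ 2 * (2 * (a 0%N ^+ 2 + b 0%N ^+ 2))); last by ring.
  by rewrite ler_wpM2l // sqr_ge0.
have : 0 <= (64 * (90 * del)) ^+ 2 * (a 0%N ^+ 2 + b 0%N ^+ 2) by rewrite mulr_ge0 ?sqr_ge0 // ltW.
lra.
Qed.

(** The angle om i may be replaced by 2 pi i / n because om n is close to 2 pi. *)
Lemma shooting_profile i : (i < n)%N ->
  `|u i - (a 0%N * cos (ang R n i) + b 0%N * sin (ang R n i))|
    <= 40 * (50 * (100 * del)) * (`|a 0%N| + `|b 0%N|).
Proof.
have ? := d0; have ? := del1; move=> i_n; rewrite -/M.
have M0 : 0 < M by [].
have hV := V_bd (ltnW i_n).
have hN : N i <= 4 * M.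
  have := NV i; have : 64 * (90 * del) * M <= 1 * M by rewrite ler_wpM2r ?(ltW ab0) //; lra.
  lra.
have h1 : `|eps i * b i| <= 12 * del * (4 * M).
  rewrite normrM; apply: ler_pM => //; first by apply: le_trans (epsE i) Ed.
  by apply: le_trans hN; rewrite /N lerDr.
have h2 : `|(A i - a 0%N) * cos (th i) + (B i - b 0%N) * sin (th i)| <= V i.
  apply: le_trans (ler_normD _ _) _; rewrite !normrM /V.
  by apply: lerD; rewrite ler_piMr // ?cos_max ?sin_max.
have ht : `|th i - ang R n i| <= 32 * (64 * (90 * del)).
  have -> : th i - ang R n i = i%:R / n%:R * (om * n%:R - 2 * pi).
    by rewrite /th /ang; field; rewrite gt_eqF.
  apply: le_trans shooting_period; rewrite normrM ler_piMl // ger0_norm.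
    by rewrite ler_pdivrMr // mul1r ler_nat ltnW.
  by rewrite divr_ge0.
have h3 : `|a 0%N * (cos (th i) - cos (ang R n i)) + b 0%N * (sin (th i) - sin (ang R n i))|
   <= 32 * (64 * (90 * del)) * M.
  apply: le_trans (ler_normD _ _) _; rewrite !normrM /M mulrDr.
  apply: lerD; rewrite mulrC ler_wpM2r //; apply: le_trans ht; [exact: cos_lip|exact: sin_lip].
have -> : u i - (a 0%N * cos (ang R n i) + b 0%N * sin (ang R n i)) = eps i * b i +
   ((A i - a 0%N) * cos (th i) + (B i - b 0%N) * sin (th i)) +
   (a 0%N * (cos (th i) - cos (ang R n i)) + b 0%N * (sin (th i) - sin (ang R n i))).
  by rewrite uE {1}[a i]aAB; ring.
apply: le_trans (ler_normD _ _) _.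
have h4 := ler_normD (eps i * b i) ((A i - a 0%N) * cos (th i) + (B i - b 0%N) * sin (th i)).
have : 0 <= del * M by rewrite mulr_ge0 // ltW.
lra.
Qed.

End Shooting.

(** * Profiles of eigenvectors *)

Section Profile.
Variables (R : realType) (n : nat).
Hypothesis n3 : (3 <= n)%N.
Implicit Types (v : 'cV[R]_n) (x y e : R).

Let n0 : 0 < n%:R :> R. Proof. by rewrite ltr0n; case: (n) n3. Qed.

Definition wave x y (i : nat) : R := x * cos (ang R n i) + y * sin (ang R n i).

Lemma wave_sqr_le x y i : wave x y i ^+ 2 <= x ^+ 2 + y ^+ 2.
Proof.
have cs := cos2Dsin2 (ang R n i); rewrite /wave.
set c := cos _ in cs *; set s := sin _ in cs *.
have -> : x ^+ 2 + y ^+ 2 = (x ^+ 2 + y ^+ 2) * (c ^+ 2 + s ^+ 2) by rewrite cs mulr1.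
have := sqr_ge0 (x * s - y * c); lra.
Qed.

(** The factor sqrt (n / 2) makes orthonormal vectors correspond to nearly
    orthonormal pairs (x, y). *)
Definition has_profile v x y e :=
  x ^+ 2 + y ^+ 2 <= 4 /\
  forall i : 'I_n, `|Num.sqrt (n%:R / 2) * v i 0 - wave x y i| <= e.

(** A pure wave of amplitude (A, B) has squared norm n (A^2 + B^2) / 2, so the
    norm of v bounds the amplitude and makes the relative error an absolute one. *)
Lemma normalize_profile v (A B t : R) : 0 <= t <= 1 / 4 -> dot v v = 1 ->
  (forall i : 'I_n, `|v i 0 - wave A B i| <= t * (`|A| + `|B|)) ->
  has_profile v (Num.sqrt (n%:R / 2) * A) (Num.sqrt (n%:R / 2) * B) (3 * t).
Proof.
move=> /andP[t0 t4] vv h; set s := Num.sqrt _.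
have n0' := n0.
have s0 : 0 <= s by apply: sqrtr_ge0.
have s2 : s ^+ 2 = n%:R / 2 by rewrite sqr_sqrtr //; lra.
have M2 : (`|A| + `|B|) ^+ 2 <= 2 * (A ^+ 2 + B ^+ 2).
  have := sqr_ge0 (`|A| - `|B|); rewrite sqrrB sqrrD !real_normK ?num_real //.
  by rewrite !mulr2n; lra.
have err (i : 'I_n) : (v i 0 - wave A B i) ^+ 2 <= t ^+ 2 * (2 * (A ^+ 2 + B ^+ 2)).
  apply: (@le_trans _ _ ((t * (`|A| + `|B|)) ^+ 2)).
    rewrite -[X in X <= _]real_normK ?num_real //.
    by rewrite ler_sqr ?nnegrE ?mulr_ge0 ?addr_ge0 ?h.
  by rewrite exprMn ler_wpM2l // sqr_ge0.
pose q := n%:R / 2 * (A ^+ 2 + B ^+ 2).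
have q0 : 0 <= q by rewrite /q mulr_ge0 ?addr_ge0 ?sqr_ge0 //; lra.
have t2 : t ^+ 2 <= 1 / 16.
  have := mulr_ge0 t0 t0; have : t * t <= 1 / 4 * (1 / 4) by apply: ler_pM.
  rewrite expr2; lra.
have qE : \sum_(i < n) wave A B i ^+ 2 = q.
  rewrite (eq_bigr (fun i : 'I_n => wave A B i * wave A B i)) => [|i _]; last exact: expr2.
  by rewrite sum_profile //.
have qle : q <= 2 + 8 * (t ^+ 2 * q).
  rewrite -qE.
  have -> : 8 * (t ^+ 2 * \sum_(i < n) wave A B i ^+ 2) =
     2 * (\sum_(i < n) t ^+ 2 * (2 * (A ^+ 2 + B ^+ 2))).
    by rewrite qE sumr_const card_ord -mulr_natl /q; field.
  have vv2 : \sum_(i < n) 2 * (v i 0 * v i 0) = 2 by rewrite -mulr_sumr -/(dot v v) vv mulr1.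
  rewrite -[X in _ <= X + _]vv2 mulr_sumr -big_split /=; apply: ler_sum => i _.
  apply: (@le_trans _ _ (2 * (v i 0 * v i 0) + 2 * (v i 0 - wave A B i) ^+ 2)).
    have := sqr_ge0 (v i 0 + (v i 0 - wave A B i)); lra.
  by apply: lerD => //; rewrite ler_wpM2l.
have q4 : q <= 4.
  have : t ^+ 2 * q <= 1 / 16 * q by rewrite ler_wpM2r.
  lra.
have sq : (s * A) ^+ 2 + (s * B) ^+ 2 = q by rewrite !exprMn s2 /q; ring.
split=> [|i]; first by rewrite sq.
rewrite -ler_sqr ?nnegrE //; last lra.
rewrite real_normK ?num_real //.
have -> : s * v i 0 - wave (s * A) (s * B) i = s * (v i 0 - wave A B i).
  by rewrite /wave; ring.
rewrite exprMn s2.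
apply: (@le_trans _ _ (n%:R / 2 * (t ^+ 2 * (2 * (A ^+ 2 + B ^+ 2))))).
  by rewrite ler_wpM2l //; lra.
have -> : n%:R / 2 * (t ^+ 2 * (2 * (A ^+ 2 + B ^+ 2))) = 2 * (t ^+ 2 * q) by rewrite /q; field.
have : t ^+ 2 * q <= t ^+ 2 * 4 by rewrite ler_wpM2l // sqr_ge0.
have := sqr_ge0 t; rewrite exprMn; lra.
Qed.

(** The inner product of two pure waves is exact, by discrete orthogonality. *)
Lemma profile_dot v v' x y x' y' e : 0 <= e <= 1 ->
  has_profile v x y e -> has_profile v' x' y' e ->
  `|dot v v' - (x * x' + y * y')| <= 10 * e.
Proof.
move=> /andP[e0 e1] [q4 h] [q4' h']; have n0' := n0.
set s := Num.sqrt (n%:R / 2) in h h'.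
have s2 : s ^+ 2 = n%:R / 2 by rewrite sqr_sqrtr //; lra.
have w2 (a b : R) (i : 'I_n) : a ^+ 2 + b ^+ 2 <= 4 -> `|wave a b i| <= 2.
  move=> ab; rewrite -ler_sqr ?nnegrE // real_normK ?num_real //.
  by apply: le_trans (wave_sqr_le _ _ _) _; lra.
have -> : dot v v' - (x * x' + y * y') = 2 / n%:R *
   (\sum_(i < n) ((s * v i 0) * (s * v' i 0) - wave x y i * wave x' y' i)).
  rewrite sumrB sum_profile // (eq_bigr (fun i => n%:R / 2 * (v i 0 * v' i 0))).
    by rewrite -mulr_sumr /dot; field; rewrite gt_eqF.
  by move=> i _; rewrite -s2; ring.
rewrite normrM ger0_norm; last by rewrite divr_ge0.
rewrite mulrAC ler_pdivrMr //.
have : `|\sum_(i < n) ((s * v i 0) * (s * v' i 0) - wave x y i * wave x' y' i)| <=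
   \sum_(i < n) 5 * e.
  apply: le_trans (ler_norm_sum _ _ _) _; apply: ler_sum => i _.
  set U := s * v i 0; set U' := s * v' i 0.
  have hU : `|U - wave x y i| <= e := h i.
  have hU' : `|U' - wave x' y' i| <= e := h' i.
  have -> : U * U' - wave x y i * wave x' y' i = (U - wave x y i) * wave x' y' i +
     (U' - wave x' y' i) * wave x y i + (U - wave x y i) * (U' - wave x' y' i) by ring.
  apply: le_trans (norm_lin3 _ _ _ hU hU' hU) _.
  have : e * `|wave x' y' i| <= e * 2 by rewrite ler_wpM2l ?w2.
  have : e * `|wave x y i| <= e * 2 by rewrite ler_wpM2l ?w2.
  have : e * `|U' - wave x' y' i| <= e * 1 by rewrite ler_wpM2l // (le_trans hU').
  lra.
rewrite sumr_const card_ord -[5 * e *+ n]mulr_natl; lra.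
Qed.

End Profile.

(** Three vectors of the plane cannot be nearly orthonormal: their Gram
    determinant vanishes. *)
Lemma no_three (R : realType) (x1 y1 x2 y2 x3 y3 t : R) : 0 <= t <= 1 / 10 ->
  `|1 - (x1 * x1 + y1 * y1)| <= t -> `|1 - (x2 * x2 + y2 * y2)| <= t ->
  `|1 - (x3 * x3 + y3 * y3)| <= t -> `|x1 * x2 + y1 * y2| <= t ->
  `|x1 * x3 + y1 * y3| <= t -> `|x2 * x3 + y2 * y3| <= t -> False.
Proof.
move=> /andP[t0 t1].
set g1 := x1 * x1 + _; set g2 := x2 * x2 + _; set g3 := x3 * x3 + _.
set h3 := x1 * x2 + _; set h2 := x1 * x3 + _; set h1 := x2 * x3 + _.
have det0 : g1 * g2 * g3 + 2 * (h1 * h2 * h3) - g1 * h1 ^+ 2 - g2 * h2 ^+ 2 - g3 * h3 ^+ 2 = 0.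
  rewrite /g1 /g2 /g3 /h1 /h2 /h3; ring.
clearbody g1 g2 g3 h1 h2 h3.
rewrite !ler_norml => /andP[a1 b1] /andP[a2 b2] /andP[a3 b3] p3 p2 p1.
have sq (h : R) : - t <= h <= t -> h ^+ 2 <= 1 / 100 /\ `|h| <= 1 / 10.
  move=> ht; have h' : `|h| <= 1 / 10 by rewrite ler_norml; lra.
  split=> //; rewrite -real_normK ?num_real // expr2.
  by apply: le_trans (ler_pM _ _ h' h') _ => //; lra.
have [s1 n1] := sq _ p1; have [s2 n2] := sq _ p2; have [s3 n3] := sq _ p3.
have prod : `|h1 * h2 * h3| <= 1 / 10 * (1 / 10) * (1 / 10).
  by rewrite !normrM; apply: ler_pM; rewrite ?mulr_ge0 //; apply: ler_pM.
have gg : 9 / 10 * (9 / 10) * (9 / 10) <= g1 * g2 * g3.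
  by apply: ler_pM; [lra|lra| apply: ler_pM; lra | lra].
have gh (g h : R) : g <= 11 / 10 -> 0 <= g -> h ^+ 2 <= 1 / 100 -> g * h ^+ 2 <= 11 / 10 * (1 / 100).
  by move=> *; apply: ler_pM => //; apply: sqr_ge0.
have q1 : g1 * h1 ^+ 2 <= 11 / 10 * (1 / 100) by apply: gh => //; lra.
have q2 : g2 * h2 ^+ 2 <= 11 / 10 * (1 / 100) by apply: gh => //; lra.
have q3 : g3 * h3 ^+ 2 <= 11 / 10 * (1 / 100) by apply: gh => //; lra.
move: prod; rewrite ler_norml => /andP[r1 r2].
lra.
Qed.

(** * The weighted cycle *)

(** Cauchy-Schwarz, as nonnegativity of the variance of a_i / r_i under the
    weights r_i. *)
Lemma titu (R : realType) (I : finType) (r a : I -> R) :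
  (forall i, 0 < r i) ->
  (\sum_i a i) ^+ 2 <= (\sum_i r i) * (\sum_i a i ^+ 2 / r i).
Proof.
move=> r0; set X := \sum_i a i; set S := \sum_i r i; set Q := \sum_i _ / _.
have S0 : 0 <= S by apply: sumr_ge0 => i _; exact: ltW.
have Q0 : 0 <= Q by apply: sumr_ge0 => i _; rewrite divr_ge0 ?sqr_ge0 ?ltW.
have [Se|Sn] := eqVneq S 0.
  rewrite Se mul0r /X big1 ?expr0n // => i _.
  have ri : r i = 0 by apply: (psumr_eq0P _ Se) => // j _; exact: ltW.
  by have := r0 i; rewrite ri ltxx.
have {Sn} S0' : 0 < S by rewrite lt_neqAle eq_sym Sn.
have : 0 <= \sum_i r i * (a i / r i - X / S) ^+ 2.
  by apply: sumr_ge0 => i _; rewrite mulr_ge0 ?sqr_ge0 ?ltW.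
have -> : \sum_i r i * (a i / r i - X / S) ^+ 2 =
   \sum_i (a i ^+ 2 / r i + (- (2 * (X / S))) * a i + (X / S) ^+ 2 * r i).
  by apply: eq_bigr => i _; field; rewrite !gt_eqF.
rewrite !big_split /= -!mulr_sumr -/X -/S -/Q => h.
have e : Q + (- (2 * (X / S))) * X + (X / S) ^+ 2 * S = Q - X ^+ 2 / S.
  by field; rewrite gt_eqF.
by move: h; rewrite e subr_ge0 ler_pdivrMr // mulrC.
Qed.

Section Cycle.
Variables (R : realType) (n : nat) (c : 'I_n -> R).
Implicit Types (v : 'cV[R]_n) (i p q : 'I_n).

Lemma laplacian_mul v i : (laplacian c *m v) i 0 =
  c i * (v i 0 - v (ordS i) 0) + c (ord_pred i) * (v i 0 - v (ord_pred i) 0).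
Proof.
rewrite /laplacian mulmxBl /cycle_deg mul_diag_mx !mxE mulr_suml -sumrB.
rewrite (eq_bigr (fun j => (j == ordS i)%:R * (c i * (v i 0 - v j 0)) +
   (j == ord_pred i)%:R * (c j * (v i 0 - v j 0)))); last first.
  move=> j _; rewrite !mxE.
  have -> : (j == ord_pred i) = (i == ordS j).
    by apply/eqP/eqP => [->|->]; rewrite ?ord_predK ?ordSK.
  by ring.
rewrite big_split /=; congr (_ + _).
  rewrite (bigD1 (ordS i)) //= eqxx mul1r big1 ?addr0 // => j /negPf ->.
  by rewrite mul0r.
rewrite (bigD1 (ord_pred i)) //= eqxx mul1r big1 ?addr0 // => j /negPf ->.
by rewrite mul0r.
Qed.

Lemma laplacian_sym : (laplacian c)^T = laplacian c.
Proof.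
rewrite /laplacian linearB /= /cycle_deg tr_diag_mx; congr (_ - _).
by apply/matrixP => i j; rewrite !mxE addrC.
Qed.

Lemma laplacian_form v :
  dot v (laplacian c *m v) = \sum_i c i * (v (ordS i) 0 - v i 0) ^+ 2.
Proof.
rewrite /dot (eq_bigr (fun i => v i 0 * (c i * (v i 0 - v (ordS i) 0)) +
   v i 0 * (c (ord_pred i) * (v i 0 - v (ord_pred i) 0)))); last first.
  by move=> i _; rewrite laplacian_mul mulrDr.
rewrite big_split /= [X in _ + X](reindex_inj (@ordS_inj n)) -big_split /=.
by apply: eq_bigr => i _; rewrite ordSK; ring.
Qed.

Definition cdiff p q : 'cV[R]_n := evec R p - evec R q.

Lemma dot_cdiff v p q : dot v (cdiff p q) = v p 0 - v q 0.
Proof.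
have dote r : dot v (evec R r) = v r 0.
  rewrite /dot (bigD1 r) //= big1 ?addr0 ?mxE ?eqxx ?mulr1 // => i /negPf ir.
  by rewrite mxE ir mulr0.
by rewrite /cdiff dotDr dotNr !dote.
Qed.

Lemma chord_form v p q w : dot v (laplacian_chord c p q w *m v) =
  dot v (laplacian c *m v) + w * (v p 0 - v q 0) ^+ 2.
Proof.
rewrite /laplacian_chord mulmxDl dotDr -scalemxAl dotZr -/(cdiff p q).
by rewrite -mulmxA dotE mul_mx_scalar dotZr (dotC _ v) !dot_cdiff expr2.
Qed.

Lemma chord_sym p q w : (laplacian_chord c p q w)^T = laplacian_chord c p q w.
Proof.
by rewrite /laplacian_chord linearD /= laplacian_sym linearZ /= trmx_mul trmxK.
Qed.

Hypothesis n_gt0 : (0 < n)%N.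
Let p0 : 'I_n := Ordinal n_gt0.
(** Vertices indexed by all natural numbers, so that going around the cycle is
    a plain recursion. *)
Definition vtx k : 'I_n := iter k (@ordS n) p0.

Lemma vtxE k : (k < n)%N -> vtx k = k :> nat.
Proof.
elim: k => [//|k IH] kn; rewrite /= -/(vtx k) IH; last exact: ltnW.
by rewrite modn_small.
Qed.

Lemma vtx_ord i : vtx i = i.
Proof. by apply: val_inj; rewrite /= vtxE. Qed.

Lemma vtxn : vtx n = p0.
Proof.
suff h k : k.+1 = n -> vtx k.+1 = p0.
  by move: (h n.-1 (prednK n_gt0)); rewrite (prednK n_gt0).
move=> kn; have k_n : (k < n)%N by rewrite -[X in (_ < X)%N]kn.
by apply: val_inj; rewrite /= -/(vtx k) vtxE // [X in (X %% _)%N]kn modnn.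
Qed.

Lemma vtxD k : vtx (n + k) = vtx k.
Proof. by rewrite addnC /vtx iterD -/(vtx n) vtxn. Qed.

Lemma sum_vtx (F : 'I_n -> R) : \sum_i F i = \sum_(k < n) F (vtx k).
Proof. by apply: eq_bigr => i _; rewrite vtx_ord. Qed.

(** The resistance position, extended beyond the first turn. *)
Definition rpos k := arc_res c p0 k.

Lemma rposS k : rpos k.+1 = rpos k + res c (vtx k).
Proof. by rewrite /rpos /arc_res big_ord_recr. Qed.

Lemma rpos0 : rpos 0 = 0.
Proof. by rewrite /rpos /arc_res big_ord0. Qed.

Lemma rposn : rpos n = total_res c.
Proof. by rewrite /total_res sum_vtx. Qed.

Lemma posE p : pos c p = rpos p.
Proof.
rewrite /rpos /arc_res (big_ord_widen n (fun j => res c (iter j (@ordS n) p0))) //.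
  by apply: eq_bigr => i _; rewrite -[in LHS](vtx_ord i).
exact/ltnW.
Qed.

Lemma rposD k : rpos (n + k) = total_res c + rpos k.
Proof.
elim: k => [|k IH]; first by rewrite addn0 rposn rpos0 addr0.
by rewrite addnS !rposS IH vtxD addrA.
Qed.

End Cycle.

Section Positive.
Variables (R : realType) (n : nat) (c : 'I_n -> R).
Hypotheses (n_gt0 : (0 < n)%N) (c0 : forall i, 0 < c i).
Implicit Types (v : 'cV[R]_n) (i p q : 'I_n).
Let S := total_res c.
Let nR : 0 < n%:R :> R. Proof. by rewrite ltr0n. Qed.

Lemma res_gt0 i : 0 < res c i. Proof. by rewrite invr_gt0. Qed.

Lemma total_gt0 : 0 < S.
Proof.
rewrite /S /total_res (bigD1 (Ordinal n_gt0)) //=.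
apply: ltr_pwDl; first exact: res_gt0.
by apply: sumr_ge0 => i _; rewrite ltW // res_gt0.
Qed.

(** The drop is a sum of drops along a path, to which Cauchy-Schwarz applies with
    the resistances as weights; the effective resistance between two vertices is
    at most the total one. *)
Lemma potential_drop v p q :
  (v p 0 - v q 0) ^+ 2 <= S * dot v (laplacian c *m v).
Proof.
wlog pq : p q / (p <= q)%N.
  by move=> h; have [/h //|/ltnW/h] := leqP p q; rewrite -sqrrN opprB.
pose V k := v (vtx n_gt0 k) 0.
have h : `|v p 0 - v q 0| <= \sum_i `|v (ordS i) 0 - v i 0|.
  rewrite (sum_vtx n_gt0 (fun i => `|v (ordS i) 0 - v i 0|)).
  rewrite -(vtx_ord n_gt0 p) -(vtx_ord n_gt0 q) -/(V p) -/(V q) distrC.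
  rewrite -(telescope_sumr V pq) -(big_mkord xpredT (fun k => `|V k.+1 - V k|)).
  apply: le_trans (ler_norm_sum _ _ _) _.
  rewrite (@big_cat_nat _ _ _ p 0%N n) //=; last exact/ltnW.
  rewrite (@big_cat_nat _ _ _ q p n) //=; last exact/ltnW.
  by rewrite addrCA lerDl addr_ge0 // sumr_ge0.
apply: (@le_trans _ _ ((\sum_i `|v (ordS i) 0 - v i 0|) ^+ 2)).
  rewrite -[X in X <= _]real_normK ?num_real // ler_sqr ?nnegrE //.
  by rewrite sumr_ge0.
apply: le_trans (titu _ res_gt0) _; rewrite laplacian_form.
rewrite le_eqVlt; apply/orP; left; apply/eqP; congr (_ * _); apply: eq_bigr => i _.
by rewrite real_normK ?num_real // /res invrK mulrC.
Qed.

(** A function of zero mean takes a value of the opposite sign, so each of its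
    values is bounded by a potential drop. *)
Lemma poincare v : dot v (const_mx 1) = 0 ->
  dot v v <= n%:R * S * dot v (laplacian c *m v).
Proof.
move=> v1; have s0 : \sum_i v i 0 = 0.
  by rewrite -[RHS]v1; apply: eq_bigr => i _; rewrite mxE mulr1.
have main p : v p 0 * v p 0 <= S * dot v (laplacian c *m v).
  have [q hq] : exists q, v p 0 * v q 0 <= 0.
    apply/existsP; rewrite -[X in is_true X]negbK negb_exists; apply/negP => /forallP h.
    have : 0 < \sum_q v p 0 * v q 0.
      rewrite (bigD1 p) //=; apply: ltr_pwDl; first by rewrite ltNge h.
      by apply: sumr_ge0 => i _; rewrite ltW // ltNge h.
    by rewrite -mulr_sumr s0 mulr0 ltxx.
  have := potential_drop v p q; have := sqr_ge0 (v q 0); lra.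
rewrite /dot in main *; apply: le_trans (ler_sum _ (fun i _ => main i)) _.
by rewrite sumr_const card_ord -[X in X <= _]mulr_natl mulrA.
Qed.

Let del := delta_n c.

Lemma max_discr_ge0 : 0 <= max_discr c.
Proof.
have max0 (x y : R) : 0 <= x -> 0 <= y -> 0 <= Num.max x y by rewrite le_max => ->.
by apply: (big_ind (fun x => 0 <= x)) => // p _; apply: (big_ind (fun x => 0 <= x)).
Qed.

Lemma res_le_max i : res c i <= max_res c.
Proof. exact: le_bigmax. Qed.

Lemma max_res_le : max_res c <= del * S.
Proof.
rewrite /del /delta_n /discrepancy /max_res_ratio -mulrDl divfK ?gt_eqF ?total_gt0 //.
by rewrite lerDr max_discr_ge0.
Qed.

Lemma discr_le : max_discr c <= del * S.
Proof.
rewrite /del /delta_n /discrepancy /max_res_ratio -mulrDl divfK ?gt_eqF ?total_gt0 //.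
by rewrite lerDl; apply: (le_trans _ (res_le_max (Ordinal n_gt0))); rewrite ltW // res_gt0.
Qed.

(** The total resistance is at most n times the maximal one. Hence a small
    delta_n makes n large. *)
Lemma delta_n_ge : 1 <= del * n%:R.
Proof.
rewrite -(ler_pM2r total_gt0) mul1r.
have : S <= n%:R * max_res c.
  apply: le_trans (ler_sum _ (fun i _ => res_le_max i)) _.
  by rewrite sumr_const card_ord -[X in X <= _]mulr_natl.
move=> h; apply: (le_trans h); rewrite mulrAC mulrC.
by rewrite ler_wpM2r ?max_res_le // ltW.
Qed.

(** The discrepancy bounds the first turn; each further turn adds S both to the
    position and to its mean value. *)
Lemma rpos_close k : `|rpos c n_gt0 k - k%:R * (S / n%:R)| <= del * S.
Proof.
elim/ltn_ind: k => k IH.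
have [kn|nk] := leqP n k.
  have kE : k = (n + (k - n))%N by rewrite subnKC.
  rewrite kE rposD natrD mulrDl [n%:R * _]mulrC divfK ?gt_eqF // -/S.
  rewrite opprD addrACA subrr add0r; apply: IH.
  by rewrite ltn_subrL n_gt0 (leq_trans n_gt0 kn).
have [->|k0] := posnP k.
  rewrite rpos0 mul0r subrr normr0; apply: le_trans discr_le; exact: max_discr_ge0.
apply: le_trans discr_le.
have -> : k%:R * (S / n%:R) = k%:R / n%:R * total_res c by rewrite mulrAC mulrA.
apply: le_trans (le_bigmax _ _ (Ordinal n_gt0)).
apply: (le_bigmax_seq 0 k xpredT (fun l => `|arc_res c (Ordinal n_gt0) l - l%:R / n%:R * total_res c|)) => //.
by rewrite mem_index_iota k0 ltnW.
Qed.

End Positive.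

(** * Low eigenvalues of the cycle *)

Section Low.
Variables (R : realType) (n : nat) (c : 'I_n -> R).
Hypotheses (n3 : (3 <= n)%N) (c0 : forall i, 0 < c i).
Let n_gt0 : (0 < n)%N. Proof. exact: ltnW (ltnW n3). Qed.
Let S := total_res c.
Let del := delta_n c.
Let L := laplacian c.
Let nR : 0 < n%:R :> R. Proof. by rewrite ltr0n. Qed.
Let S0 : 0 < S. Proof. exact: total_gt0. Qed.
Let nd : 1 <= del * n%:R. Proof. exact: delta_n_ge. Qed.
Let d0 : 0 < del.
Proof. by rewrite -(pmulr_lgt0 _ nR); apply: lt_le_trans nd. Qed.

(** Write V_k for the potential, h_k for the flux entering vertex k and
    d_k = rpos k - k S / n. The increment of d_k is the resistance of the edge
    minus the mean one, so in V_k - d_k h_k the fluctuating resistance is replaced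
    by its mean, at the cost of d_k (h_k - h_(k+1)) = lam d_k V_k, which is small. *)
Lemma eigenvector_profile (v : 'cV[R]_n) lam :
  40 * (50 * (100 * del)) <= 1 / 4 ->
  dot v v = 1 -> L *m v = lam *: v -> 1 <= lam * (n%:R * S) <= (3 * pi) ^+ 2 ->
  `|Num.sqrt (lam * (n%:R * S)) - 2 * pi| <= 32 * (64 * (90 * del)) /\
  exists x y, has_profile v x y (3 * (40 * (50 * (100 * del)))).
Proof.
move=> dsmall vv Lv /andP[lam1 lam9].
pose q := Num.sqrt (lam * (n%:R * S)); rewrite -/q.
have q2 : q ^+ 2 = lam * (n%:R * S) by rewrite sqr_sqrtr //; lra.
have q0 : 0 <= q by rewrite sqrtr_ge0.
have q1 : 1 <= q by rewrite -ler_sqr ?nnegrE // q2 expr1n.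
have p0 := pi_gt0 R.
have q3 : q <= 3 * pi by rewrite -ler_sqr ?nnegrE // ?q2 //; lra.
have q12 : q <= 12 by have := pi_le4 R; lra.
pose om := q / n%:R; pose nu := q / S.
have nS := gt_eqF S0; have nn := gt_eqF nR.
have omn : om * n%:R = q by rewrite /om divfK // nn.
have nu0 : 0 < nu by rewrite divr_gt0 //; lra.
pose V k := v (vtx n_gt0 k) 0.
pose h k := c (ord_pred (vtx n_gt0 k)) * (V k - v (ord_pred (vtx n_gt0 k)) 0).
pose d k := rpos c n_gt0 k - k%:R * (S / n%:R).
pose eps k := d k * nu.
pose a k := V k - d k * h k.
pose b k := h k / nu.
have hE k : h k.+1 = c (vtx n_gt0 k) * (V k.+1 - V k).
  by rewrite /h /= ordSK.
have hS k : h k.+1 = h k - lam * V k.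
  have := laplacian_mul c v (vtx n_gt0 k); rewrite -/L Lv mxE -/(V k).
  rewrite hE /h -/(V k) => ->; rewrite -[ordS _]/(vtx n_gt0 k.+1) -/(V k.+1); ring.
have VS k : V k.+1 = V k + res c (vtx n_gt0 k) * h k.+1.
  by rewrite hE /res mulrA mulVf ?gt_eqF // mul1r addrC subrK.
have dS k : d k.+1 = d k + res c (vtx n_gt0 k) - S / n%:R.
  by rewrite /d rposS -natr1; ring.
have bS k : b k.+1 = b k - om * V k.
  rewrite /b hS /om mulrBl; congr (_ - _).
  rewrite /nu -[lam](mulfK (x := n%:R * S)) -?q2; last by rewrite mulf_neq0 ?nn ?nS.
  by field; rewrite nn nS /= gt_eqF //; lra.
have lamE : lam = om * nu.
  rewrite /om /nu -[LHS](mulfK (x := n%:R * S)) -?q2; last by rewrite mulf_neq0 ?nn ?nS.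
  by field; rewrite nn nS.
have rE : S / n%:R * nu = om by rewrite /nu /om; field; rewrite nn nS.
have hb k : h k = nu * b k by rewrite /b mulrCA divff ?mulr1 // gt_eqF.
have aS k : a k.+1 = a k + om * b k.+1 + om * eps k * V k.
  rewrite /a VS dS.
  have -> : om * b k.+1 = S / n%:R * h k.+1 by rewrite hb -rE; ring.
  have -> : om * eps k * V k = d k * (h k - h k.+1).
    by rewrite hS lamE /eps; ring.
  by ring.
have uE k : V k = a k + eps k * b k.
  by rewrite /a /eps hb; ring.
have epsE k : `|eps k| <= 12 * del.
  rewrite normrM (gtr0_norm nu0).
  have := rpos_close n_gt0 c0 k; rewrite -/S -/del -/(d k) => dk.
  apply: (@le_trans _ _ (del * S * nu)); first by rewrite ler_wpM2r // ltW.
  have -> : del * S * nu = q * del by rewrite /nu; field; rewrite nS.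
  by rewrite ler_wpM2r // ltW.
have Vn : V n = V 0%N by rewrite /V vtxn.
have hn : h n = h 0%N by rewrite /h Vn vtxn.
have dn : d n = 0.
  by rewrite /d rposn -/S mulrC divfK ?nn // subrr.
have d00 : d 0%N = 0 by rewrite /d rpos0 mul0r subrr.
have an : a n = a 0%N by rewrite /a dn d00 Vn !mul0r.
have bn : b n = b 0%N by rewrite /b hn.
have ab0 : 0 < `|a 0%N| + `|b 0%N|.
  rewrite lt_neqAle addr_ge0 // andbT eq_sym paddr_eq0 // !normr_eq0.
  apply/negP => /andP[/eqP a0 /eqP b0].
  have ab k : a k = 0 /\ b k = 0.
    elim: k => [//|k [IHa IHb]]; have V0 : V k = 0 by rewrite uE IHa IHb mulr0 addr0.
    by rewrite aS bS IHa IHb V0 !mulr0 subrr mulr0 !addr0.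
  have v0 : v = 0.
    apply/colP => i; rewrite -(vtx_ord n_gt0 i) -/(V i) uE !(ab i).1 (ab i).2 mxE.
    by rewrite mulr0 addr0.
  by move: vv; rewrite v0 dot0l => /eqP; rewrite eq_sym oner_eq0.
have om1 : 1 <= om * n%:R by rewrite omn.
have om3 : om * n%:R <= 3 * pi by rewrite omn.
have hnd := nd; have hd0 := d0.
have del1 : del <= 1 / 64 / 90 by lra.
split.
  rewrite -omn.
  exact: (@shooting_period R n om (12 * del) del a b V eps).
exists (Num.sqrt (n%:R / 2) * a 0%N), (Num.sqrt (n%:R / 2) * b 0%N).
apply: normalize_profile => //; first by rewrite dsmall andbT; lra.
move=> i; have -> : v i 0 = V i by rewrite /V vtx_ord.
have i_n := ltn_ord i.
exact: (@shooting_profile R n om (12 * del) del a b V eps).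
Qed.

(** Trial space spanned by 1, cos and sin of the resistance position. Bounding
    the increments of cos and sin by the distance loses a factor 2 on the
    energy, which still bounds sqrt (lambda_2 n S) by about 2 sqrt 2 pi < 3 pi. *)
Lemma lambda2_le (u : nat -> 'cV[R]_n) :
  del <= 1 / 200 -> orthonormal_eigenbasis L u ->
  u 0%N = const_mx (Num.sqrt n%:R)^-1 ->
  lambda L 2 * (n%:R * S) <= (3 * pi) ^+ 2.
Proof.
move=> dsmall uP u0.
have p0 := pi_gt0 R; have p4 := pi_le4 R.
pose phi k := 2 * pi * rpos c n_gt0 k / S.
have nS := gt_eqF S0; have nn := gt_eqF nR.
pose W (j : 'I_3) : 'cV[R]_n := if j == 0 then const_mx 1 else
  if j == 1 then \col_i cos (phi i) else \col_i sin (phi i).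
have [t t0 tz] := nonzero_comb W (fun j : 'I_2 => u j) (ltnSn 2).
set x := \sum_i _ in tz.
pose T k := t 1 * cos (phi k) + t (inord 2) * sin (phi k).
have i2 : inord 2 = lift ord0 (lift ord0 ord0) :> 'I_3.
  by apply: val_inj; rewrite /= inordK.
have i1 : 1 = lift ord0 ord0 :> 'I_3 by apply: val_inj.
have xE (i : 'I_n) : x i 0 = t 0 + T i.
  rewrite /x !big_ord_recl big_ord0 addr0 /W /= !mxE /T mulr1 addrA i2 i1.
  by rewrite -addrA.
pose rho2 := t 1 ^+ 2 + t (inord 2) ^+ 2.
have rho0 : 0 <= rho2 by rewrite addr_ge0 ?sqr_ge0.
have cs2 (p q : R) : (t 1 * p + t (inord 2) * q) ^+ 2 <= rho2 * (p ^+ 2 + q ^+ 2).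
  by rewrite /rho2; have := sqr_ge0 (t 1 * q - t (inord 2) * p); lra.
have mass : 4 / 9 * (n%:R * rho2) <= dot x x.
  pose w i := wave n (t 1) (t (inord 2)) i.
  have e2 (i : nat) : (T i - w i) ^+ 2 <= rho2 * (64 * del ^+ 2).
    have -> : T i - w i = t 1 * (cos (phi i) - cos (ang R n i)) +
       t (inord 2) * (sin (phi i) - sin (ang R n i)) by rewrite /T /w /wave; ring.
    apply: le_trans (cs2 _ _) _; rewrite ler_wpM2l //; apply: le_trans (chord_le _ _) _.
    have := rpos_close n_gt0 c0 i; rewrite -/S -/del => hr.
    have -> : phi i - ang R n i = 2 * pi / S * (rpos c n_gt0 i - i%:R * (S / n%:R)).
      by rewrite /phi /ang; field; rewrite nS nn.
    rewrite -[X in X <= _]real_normK ?num_real //.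
    have -> : 64 * del ^+ 2 = (8 * del) ^+ 2 by ring.
    have hd0 := d0.
    rewrite ler_sqr ?nnegrE //; last by lra.
    rewrite normrM [`|2 * pi / S|]ger0_norm; last by rewrite divr_ge0 ?(ltW S0) //; lra.
    apply: (@le_trans _ _ (2 * pi / S * (del * S))).
      by rewrite ler_wpM2l // divr_ge0 ?(ltW S0) //; lra.
    have -> : 2 * pi / S * (del * S) = 2 * pi * del by field; rewrite nS.
    by rewrite ler_wpM2r ?(ltW d0) //; lra.
  have sw1 : \sum_(i < n) 2 * t 0 * w i = 0 by rewrite -mulr_sumr sum_profile1 ?mulr0.
  have sw2 : \sum_(i < n) w i * w i = n%:R / 2 * (t 1 * t 1 + t (inord 2) * t (inord 2)).
    exact: sum_profile.
  have s1 : \sum_(i < n) (t 0 + w i) ^+ 2 = n%:R * (t 0 ^+ 2 + rho2 / 2).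
    rewrite (eq_bigr (fun i : 'I_n => t 0 ^+ 2 + 2 * t 0 * w i + w i * w i)).
      rewrite !big_split /= sw1 sw2 addr0.
      by rewrite sumr_const card_ord -[t 0 ^+ 2 *+ n]mulr_natl /rho2; field.
    by move=> i _; ring.
  (* By AM-GM, (X - e)^2 <= (19/18) X^2 + 19 e^2; the factor 19/18 is small
     enough to get from 1/2 down to 4/9. *)
  have s2 : \sum_(i < n) (t 0 + w i) ^+ 2 <=
      19 / 18 * dot x x + n%:R * (19 * (rho2 * (64 * del ^+ 2))).
    have -> : n%:R * (19 * (rho2 * (64 * del ^+ 2))) = \sum_(i < n) 19 * (rho2 * (64 * del ^+ 2)).
      by rewrite sumr_const card_ord -[RHS]mulr_natl.
    rewrite mulr_sumr -big_split /=; apply: ler_sum => i _.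
    apply: (@le_trans _ _ (19 / 18 * (x i 0 * x i 0) + 19 * (T i - w i) ^+ 2)).
      rewrite xE; have := sqr_ge0 ((t 0 + T i) + 18 * (T i - w i)); lra.
    by have := e2 i; lra.
  have d2 : del ^+ 2 <= 1 / 200 * (1 / 200).
    by rewrite expr2; apply: ler_pM => //; exact: ltW d0.
  have nr : 0 <= n%:R * rho2 by rewrite mulr_ge0.
  have h1 : n%:R * rho2 * del ^+ 2 <= n%:R * rho2 * (1 / 200 * (1 / 200)).
    by rewrite ler_wpM2l.
  have h2 : 0 <= n%:R * t 0 ^+ 2 by rewrite mulr_ge0 ?sqr_ge0.
  by rewrite s1 in s2; lra.
have Tn : T n = T 0%N.
  rewrite /T /phi rposn rpos0 -/S mulfK ?nS // mulr0 mul0r.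
  by rewrite mulr_natl cos2pi sin2pi cos0 sin0.
have xV k : (k <= n)%N -> x (vtx n_gt0 k) 0 = t 0 + T k.
  rewrite leq_eqVlt => /orP[/eqP ->|kn]; first by rewrite vtxn xE Tn.
  by rewrite xE vtxE.
have energy : dot x (L *m x) <= rho2 * (2 * pi / S) ^+ 2 * S.
  have SE : S = \sum_(k < n) res c (vtx n_gt0 k) by rewrite /S /total_res (sum_vtx n_gt0).
  rewrite /L laplacian_form (sum_vtx n_gt0) [X in _ <= _ * X]SE mulr_sumr.
  apply: ler_sum => k _; have ck := c0 (vtx n_gt0 k).
  rewrite (xV k) ?(ltnW (ltn_ord k)) // -[ordS _]/(vtx n_gt0 k.+1) xV //.
  apply: (@le_trans _ _ (c (vtx n_gt0 k) * (rho2 * (phi k.+1 - phi k) ^+ 2))).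
    rewrite ler_wpM2l ?(ltW ck) //.
    have -> : t 0 + T k.+1 - (t 0 + T k) = t 1 * (cos (phi k.+1) - cos (phi k)) +
       t (inord 2) * (sin (phi k.+1) - sin (phi k)) by rewrite /T; ring.
    by apply: le_trans (cs2 _ _) _; rewrite ler_wpM2l // chord_le.
  rewrite le_eqVlt; apply/orP; left; apply/eqP.
  by rewrite /phi rposS /res; field; rewrite nS gt_eqF.
have x0 : x != 0.
  apply/eqP => x0; move: mass; rewrite x0 dot0l => mass.
  have r0 : rho2 = 0.
    apply/eqP; rewrite eq_le rho0 andbT -(pmulr_rle0 _ nR); lra.
  move: (r0) => /eqP; rewrite /rho2 paddr_eq0 ?sqr_ge0 // !sqrf_eq0 => /andP[/eqP t1 /eqP t2].
  have t00 : t 0 = 0.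
    have := xE (Ordinal n_gt0); rewrite x0 mxE /T t1 t2 !mul0r !addr0.
    by move=> <-.
  case: t0 => j; case: j => [[|[|[|//]]]] hj.
  - by rewrite (_ : Ordinal hj = 0) ?t00 ?eqxx //; apply: val_inj.
  - by rewrite (_ : Ordinal hj = 1) ?t1 ?eqxx //; apply: val_inj.
  - by rewrite (_ : Ordinal hj = inord 2) ?t2 ?eqxx //; apply: val_inj; rewrite /= inordK.
have main : lambda L 2 <= (3 * pi) ^+ 2 / (n%:R * S).
  apply: (lambda_le (laplacian_sym c) uP x0) => [j j2 _|].
    by have := tz (Ordinal j2).
  apply: le_trans energy _.
  have -> : rho2 * (2 * pi / S) ^+ 2 * S = (3 * pi) ^+ 2 / (n%:R * S) * (4 / 9 * (n%:R * rho2)).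
    by field; rewrite nn nS.
  by rewrite ler_wpM2l // divr_ge0 ?sqr_ge0 // mulr_ge0 // ltW.
by rewrite -ler_pdivlMr // mulr_gt0.
Qed.

End Low.

(** * Adding a chord *)

(** AM-GM for the products r b and s a. *)
Lemma cross_le (R : realType) (r s a b p q : R) :
  0 <= r -> 0 <= s -> 0 <= a -> 0 <= b ->
  p ^+ 2 <= r * a -> q ^+ 2 <= s * b -> 2 * (p * q) <= r * b + s * a.
Proof.
move=> r0 s0 a0 b0 hp hq.
have rb0 : 0 <= r * b by rewrite mulr_ge0.
have sa0 : 0 <= s * a by rewrite mulr_ge0.
have h : (p * q) ^+ 2 <= (r * b) * (s * a).
  rewrite exprMn; apply: (@le_trans _ _ ((r * a) * (s * b))).
    by apply: ler_pM => //; exact: sqr_ge0.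
  by rewrite le_eqVlt; apply/orP; left; apply/eqP; ring.
apply: le_trans (ler_norm _) _.
rewrite -ler_sqr ?nnegrE ?addr_ge0 // real_normK ?num_real //.
have := sqr_ge0 (r * b - s * a); rewrite exprMn sqrrB sqrrD !mulr2n; lra.
Qed.

Lemma cauchy3 (R : realType) (r1 r2 r3 a1 a2 a3 p1 p2 p3 : R) :
  0 <= r1 -> 0 <= r2 -> 0 <= r3 -> 0 <= a1 -> 0 <= a2 -> 0 <= a3 ->
  p1 ^+ 2 <= r1 * a1 -> p2 ^+ 2 <= r2 * a2 -> p3 ^+ 2 <= r3 * a3 ->
  (p1 + p2 + p3) ^+ 2 <= (r1 + r2 + r3) * (a1 + a2 + a3).
Proof.
move=> r1p r2p r3p a1p a2p a3p h1 h2 h3.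
have h12 := cross_le r1p r2p a1p a2p h1 h2.
have h13 := cross_le r1p r3p a1p a3p h1 h3.
have h23 := cross_le r2p r3p a2p a3p h2 h3.
have -> : (p1 + p2 + p3) ^+ 2 = p1 ^+ 2 + p2 ^+ 2 + p3 ^+ 2 + 2 * (p1 * p2) +
  2 * (p1 * p3) + 2 * (p2 * p3) by ring.
by lra.
Qed.

(** The level l1 is handled by Cauchy-Schwarz: b1 t1 is the chord drop minus the
    contributions of t2 and q, which are controlled by the terms with weights w,
    tau g and 1/2 of the right-hand side. *)
Lemma secular_ineq (R : realType) (l1 l2 g w S tau b1 b2 t1 t2 q Y Z : R) :
  l2 = l1 + g -> 0 < g -> 0 < tau <= 1 -> 0 < w -> 0 < S ->
  g * (w^-1 + 2 * S) + b2 ^+ 2 / tau <= b1 ^+ 2 ->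
  0 <= Z -> 2 * (l2 * Z) <= Y -> 0 <= Y -> q ^+ 2 <= S * Y ->
  (l1 + g * (1 - tau)) * (t1 ^+ 2 + t2 ^+ 2 + Z) <=
    l1 * t1 ^+ 2 + l2 * t2 ^+ 2 + Y + w * (t1 * b1 + t2 * b2 + q) ^+ 2.
Proof.
move=> l2E g0 /andP[tau0 tau1] w0 S0 cond Z0 YZ Y0 qY.
set P := t1 * b1 + t2 * b2 + q.
pose K := w^-1 + b2 ^+ 2 / (tau * g) + 2 * S.
pose X := w * P ^+ 2 + tau * g * t2 ^+ 2 + Y / 2.
have wi0 : 0 < w^-1 by rewrite invr_gt0.
have tg0 : 0 < tau * g by rewrite mulr_gt0.
have b20 : 0 <= b2 ^+ 2 / (tau * g) by rewrite divr_ge0 ?sqr_ge0 // ltW.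
have K0 : 0 < K by rewrite /K; lra.
have h1 : (b1 * t1) ^+ 2 <= K * X.
  have -> : b1 * t1 = P + - (t2 * b2) + - q by rewrite /P; ring.
  apply: cauchy3; rewrite ?sqrrN ?exprMn //; try lra.
  - by rewrite mulr_ge0 ?sqr_ge0 // ltW.
  - by rewrite mulr_ge0 ?sqr_ge0 // ltW.
  - by rewrite mulrA mulVf ?mul1r // gt_eqF.
  - rewrite le_eqVlt; apply/orP; left; apply/eqP; field.
    by rewrite !gt_eqF.
have gK : g * K <= b1 ^+ 2.
  have -> : g * K = g * (w^-1 + 2 * S) + b2 ^+ 2 / tau.
    by rewrite /K; field; rewrite !gt_eqF.
  exact: cond.
have h2 : g * t1 ^+ 2 <= X.
  rewrite -(ler_pM2l K0); apply: le_trans h1.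
  rewrite mulrA (mulrC K) exprMn; apply: ler_wpM2r => //; exact: sqr_ge0.
have h3 : 0 <= tau * g * t1 ^+ 2 by rewrite mulr_ge0 ?sqr_ge0 // ltW.
have h4 : 0 <= tau * g * Z by rewrite mulr_ge0 // ltW.
rewrite l2E in YZ *; rewrite /X in h2.
lra.
Qed.

Section Chord.
Variables (R : realType) (n : nat) (c : 'I_n -> R) (u : nat -> 'cV[R]_n) (w : R).
Hypotheses (n3 : (3 < n)%N) (c0 : forall i, 0 < c i) (w0 : 0 < w).
Let L := laplacian c.
Hypotheses (uP : orthonormal_eigenbasis L u)
  (u0 : u 0%N = const_mx (Num.sqrt n%:R)^-1).
Let S := total_res c.
Let n_gt0 : (0 < n)%N. Proof. exact: leq_trans n3. Qed.
Let nR : 0 < n%:R :> R. Proof. by rewrite ltr0n. Qed.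
Let S0 : 0 < S. Proof. exact: total_gt0. Qed.
Let sL : L^T = L. Proof. exact: laplacian_sym. Qed.

Lemma dot_u0 x : dot x (u 0%N) = (Num.sqrt n%:R)^-1 * dot x (const_mx 1).
Proof.
rewrite u0 -dotZr; congr dot; apply/colP => i.
by rewrite !mxE mulr1.
Qed.

Lemma dot_u0_eq0 x : dot x (const_mx 1) = 0 -> dot x (u 0%N) = 0.
Proof. by move=> h; rewrite dot_u0 h mulr0. Qed.

Lemma eigen_perp_const k : (0 < k < n)%N -> dot (u k) (const_mx 1) = 0.
Proof.
move=> /andP[k0 kn]; have := basis_dot uP kn n_gt0.
rewrite (gtn_eqF k0) dot_u0 => /eqP; rewrite mulf_eq0 => /orP[|/eqP //].
by rewrite invr_eq0 gt_eqF // sqrtr_gt0.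
Qed.

(** The perturbation is positive semidefinite. *)
Lemma gain_ge0 p q : 0 <= gain c w p q.
Proof.
rewrite /gain subr_ge0.
apply: (@lambda_ge _ _ _ _ (chord_sym c p q w) (projT2 (cid (symm_eigenbasis (chord_sym c p q w))))
   1 _ (fun _ => const_mx 1) (leq_trans _ n3)) => // x /(_ 0) hx.
rewrite chord_form; have h : 0 <= w * (x p 0 - x q 0) ^+ 2.
  by rewrite mulr_ge0 ?sqr_ge0 // ltW.
have : lambda L 1 * dot x x <= dot x (L *m x).
  apply: (rayleigh_ge sL uP) => -[_ _|//]; exact: dot_u0_eq0 hx.
by rewrite -/L; lra.
Qed.

(** Interlacing: the span of u_0, u_1, u_2 contains a vector on which the
    perturbation vanishes and which is orthogonal to the bottom eigenvector of
    the perturbed matrix. *)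
Lemma gain_le_gap p q : gain c w p q <= lambda L 2 - lambda L 1.
Proof.
rewrite /gain lerD2r; have [v vP] := symm_eigenbasis (chord_sym c p q w).
have [t t0 tz] := nonzero_comb (fun i : 'I_3 => u i)
   (fun j : 'I_2 => if j == 0 then v 0%N else cdiff R p q) (ltnSn 2).
set x := \sum_i _ in tz.
have x0 : x != 0 by apply: (basis_comb_neq0 uP) => //; exact: ltnW.
apply: (lambda_le (chord_sym c p q w) vP x0) => [[|//] _ _|]; first exact: tz 0.
have := tz 1; rewrite /= dot_cdiff => h.
rewrite chord_form h expr0n mulr0 addr0.
exact: (rayleigh_le sL uP t (ltnW n3)).
Qed.

(** The secular inequality, applied to the components of x on u_1 and u_2 and to
    the rest y, for which the resistance bound controls the chord drop and
    lambda_3 the norm. *)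
Lemma gain_lower p q tau :
  0 < lambda L 1 -> lambda L 1 < lambda L 2 -> 2 * lambda L 2 <= lambda L 3 ->
  0 < tau <= 1 ->
  (lambda L 2 - lambda L 1) * (w^-1 + 2 * S) + (u 2%N p 0 - u 2%N q 0) ^+ 2 / tau
     <= beta1 u p q ^+ 2 ->
  (lambda L 2 - lambda L 1) * (1 - tau) <= gain c w p q.
Proof.
move=> l10 l12 l23 tau01 cond; rewrite /gain lerBrDl.
set g := lambda L 2 - lambda L 1.
apply: (@lambda_ge _ _ _ _ (chord_sym c p q w) (projT2 (cid (symm_eigenbasis (chord_sym c p q w))))
   1 _ (fun _ => const_mx 1) (leq_trans _ n3)) => // x /(_ 0) hx.
have n1 : (1 < n)%N by apply: leq_trans n3.
have n2 : (2 < n)%N by apply: leq_trans n3.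
pose t1 := dot x (u 1%N); pose t2 := dot x (u 2%N).
have [y yE] : exists y, y = x - t1 *: u 1%N - t2 *: u 2%N by eexists.
have d11 := basis_dot uP n1 n1; have d22 := basis_dot uP n2 n2.
have d12 := basis_dot uP n1 n2; have d21 := basis_dot uP n2 n1.
have d10 := basis_dot uP n1 n_gt0; have d20 := basis_dot uP n2 n_gt0.
rewrite /= in d11 d22 d12 d21 d10 d20.
have y1 : dot y (u 1%N) = 0.
  by rewrite yE !(dotDl, dotNl, dotZl) d11 d21 -/t1; ring.
have y2 : dot y (u 2%N) = 0.
  by rewrite yE !(dotDl, dotNl, dotZl) d12 d22 -/t2; ring.
have y0 : dot y (u 0%N) = 0.
  by rewrite yE !(dotDl, dotNl, dotZl) d10 d20 (dot_u0_eq0 hx); ring.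
have xE : x = t1 *: u 1%N + t2 *: u 2%N + y.
  by rewrite yE addrC addrA -addrA (addrC (t1 *: _)) addrA subrK subrK.
have xx : dot x x = t1 ^+ 2 + t2 ^+ 2 + dot y y.
  rewrite {1 2}xE !(dotDl, dotDr, dotZl, dotZr) (dotC _ y) (dotC (u 2%N) y).
  by rewrite d11 d22 d12 d21 y1 y2; ring.
have e1 := basis_eigen uP n1; have e2 := basis_eigen uP n2.
have yL (k : nat) (kn : (k < n)%N) : dot y (u k) = 0 -> dot (u k) (L *m y) = 0.
  by move=> yk; rewrite dot_sym // (basis_eigen uP kn) dotZl dotC yk mulr0.
have xLx : dot x (L *m x) = lambda L 1 * t1 ^+ 2 + lambda L 2 * t2 ^+ 2 + dot y (L *m y).
  rewrite {1 2}xE !mulmxDr -!scalemxAr e1 e2 !(dotDl, dotDr, dotZl, dotZr).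
  by rewrite (yL _ n1 y1) (yL _ n2 y2) d11 d22 d12 d21 y1 y2; ring.
have bx : x p 0 - x q 0 = t1 * beta1 u p q + t2 * (u 2%N p 0 - u 2%N q 0) + (y p 0 - y q 0).
  by rewrite {1 2}xE !mxE /beta1; ring.
have Y3 : lambda L 3 * dot y y <= dot y (L *m y).
  by apply: (rayleigh_ge sL uP) => -[|[|[|//]]].
have Y2 : 2 * (lambda L 2 * dot y y) <= dot y (L *m y).
  by apply: le_trans Y3; rewrite mulrA ler_wpM2r // dot_ge0.
have yy := dot_ge0 y.
have Y0 : 0 <= dot y (L *m y).
  by apply: le_trans Y2; rewrite mulr_ge0 // mulr_ge0 // ltW // (lt_trans l10).
rewrite chord_form -/L xx xLx bx.
apply: (@secular_ineq _ (lambda L 1) (lambda L 2) g w S tau) => //.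
- by rewrite /g addrC subrK.
- by rewrite subr_gt0.
- exact: potential_drop.
Qed.

End Chord.

(** Bessel's inequality for two nearly orthonormal vectors of the plane: their
    Gram matrix is close to the identity. *)
Lemma plane_bessel (R : realType) (x1 y1 x2 y2 a b t : R) : 0 <= t ->
  `|1 - (x1 * x1 + y1 * y1)| <= t -> `|1 - (x2 * x2 + y2 * y2)| <= t ->
  `|x1 * x2 + y1 * y2| <= t ->
  (x1 * a + y1 * b) ^+ 2 + (x2 * a + y2 * b) ^+ 2 <= (1 + 2 * t) * (a ^+ 2 + b ^+ 2).
Proof.
move=> t0 h1 h2 h3.
set p := x1 * a + y1 * b; set q := x2 * a + y2 * b.
set N := p ^+ 2 + q ^+ 2.
have N0 : 0 <= N by rewrite addr_ge0 ?sqr_ge0.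
have e : N = (p * x1 + q * x2) * a + (p * y1 + q * y2) * b by rewrite /N /p /q; ring.
have cs : N ^+ 2 <= ((p * x1 + q * x2) ^+ 2 + (p * y1 + q * y2) ^+ 2) * (a ^+ 2 + b ^+ 2).
  rewrite e; have := sqr_ge0 ((p * x1 + q * x2) * b - (p * y1 + q * y2) * a); lra.
have gram : (p * x1 + q * x2) ^+ 2 + (p * y1 + q * y2) ^+ 2 <= (1 + 2 * t) * N.
  have -> : (p * x1 + q * x2) ^+ 2 + (p * y1 + q * y2) ^+ 2 =
    p ^+ 2 * (x1 * x1 + y1 * y1) + q ^+ 2 * (x2 * x2 + y2 * y2) +
    2 * (p * q) * (x1 * x2 + y1 * y2) by ring.
  move: h1 h2 h3; set g1 := x1 * x1 + _; set g2 := x2 * x2 + _; set g3 := x1 * x2 + _ => h1 h2 h3.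
  have k1 : p ^+ 2 * g1 <= p ^+ 2 * (1 + t).
    by rewrite ler_wpM2l ?sqr_ge0 //; move: h1; rewrite ler_norml; lra.
  have k2 : q ^+ 2 * g2 <= q ^+ 2 * (1 + t).
    by rewrite ler_wpM2l ?sqr_ge0 //; move: h2; rewrite ler_norml; lra.
  have k3 : 2 * (p * q) * g3 <= N * t.
    apply: le_trans (ler_norm _) _; rewrite normrM; apply: ler_pM => //.
    rewrite ler_norml /N; have := sqr_ge0 (p - q); have := sqr_ge0 (p + q); lra.
  rewrite /N in k3 *; lra.
have [N00|Nn] := eqVneq N 0.
  by rewrite N00 mulr_ge0 ?addr_ge0 ?sqr_ge0 //; lra.
have Np : 0 < N by rewrite lt_neqAle eq_sym Nn.
rewrite -(ler_pM2l Np); apply: (le_trans cs).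
rewrite mulrA (mulrC N); apply: ler_wpM2r => //.
by rewrite addr_ge0 ?sqr_ge0.
Qed.

(** * Antipodal pairs *)

Section Wave.
Variables (R : realType) (n : nat).
Hypothesis n3 : (3 <= n)%N.
Implicit Types x y : R.
Let nR : 0 < n%:R :> R. Proof. by rewrite ltr0n; case: (n) n3. Qed.

(** The phase is taken in [0, pi] at the price of a global sign, which only the
    absolute value of a wave can ignore. *)
Lemma wave_polar x y : exists th : R, [/\ 0 <= th <= pi &
  (forall i, wave n x y i = Num.sqrt (x ^+ 2 + y ^+ 2) * cos (th - ang R n i)) \/
  (forall i, wave n x y i = - (Num.sqrt (x ^+ 2 + y ^+ 2) * cos (th - ang R n i)))].
Proof.
wlog y0 : x y / 0 <= y.
  move=> h; have [/h //|y0] := leP 0 y.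
  have [|th [t01 H]] := h (- x) (- y); first by rewrite oppr_ge0 ltW.
  exists th; split=> //; rewrite !sqrrN in H.
  have wN i : wave n x y i = - wave n (- x) (- y) i by rewrite /wave; ring.
  by case: H => H; [right|left] => i; rewrite wN H ?opprK.
set r := Num.sqrt _.
have r2 : r ^+ 2 = x ^+ 2 + y ^+ 2 by rewrite sqr_sqrtr // addr_ge0 ?sqr_ge0.
have r0 : 0 <= r by rewrite sqrtr_ge0.
have [re|rn] := eqVneq r 0.
  exists 0; split; first by rewrite lexx pi_ge0.
  left=> i; have : x ^+ 2 + y ^+ 2 = 0 by rewrite -r2 re expr0n.
  move/eqP; rewrite paddr_eq0 ?sqr_ge0 // !sqrf_eq0 => /andP[/eqP -> /eqP ->].
  by rewrite /wave re !mul0r addr0.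
have {rn} rp : 0 < r by rewrite lt_neqAle eq_sym rn.
have xr : -1 <= x / r <= 1.
  rewrite ler_pdivrMr // ler_pdivlMr // mul1r mulN1r -ler_norml.
  rewrite -ler_sqr ?nnegrE // real_normK ?num_real // r2.
  by have := sqr_ge0 y; lra.
exists (acos (x / r)); split; first by rewrite acos_ge0 // acos_lepi.
left=> i; rewrite cosB acosK ?in_itv //= sin_acos //.
have -> : Num.sqrt (1 - (x / r) ^+ 2) = y / r.
  have -> : 1 - (x / r) ^+ 2 = (y / r) ^+ 2.
    have -> : 1 = r ^+ 2 / r ^+ 2 by rewrite divff // expf_neq0 // gt_eqF.
    by rewrite r2 !expr_div_n r2 -mulrBl addrC addKr.
  by rewrite sqrtr_sqr ger0_norm // divr_ge0.
by rewrite /wave; field; rewrite gt_eqF.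
Qed.

(** The n-th roots of unity come within 2 pi / n of every direction. *)
Lemma wave_peak x y : exists i : 'I_n,
  Num.sqrt (x ^+ 2 + y ^+ 2) * (1 - 2 * pi / n%:R) <= `|wave n x y i|.
Proof.
have [th [/andP[t0 t1] H]] := wave_polar x y.
have p0 := pi_gt0 R.
set r := Num.sqrt _ in H *.
have r0 : 0 <= r by rewrite sqrtr_ge0.
pose z := th * n%:R / (2 * pi).
have z0 : 0 <= z by rewrite /z divr_ge0 ?mulr_ge0 ?(ltW nR) //; lra.
have /andP[k1 k2] := truncn_itv z0; set k := Num.truncn z in k1 k2.
have kn : (k < n)%N.
  rewrite -(ltr_nat R); apply: (le_lt_trans k1); rewrite /z ltr_pdivrMr; last lra.
  rewrite mulrC ltr_pM2l //; lra.
exists (Ordinal kn).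
have thz : th = 2 * pi / n%:R * z.
  rewrite /z; move: (gt_eqF p0); generalize (@pi R) => P hP.
  by field; rewrite hP (gt_eqF nR).
have pn0 : 0 < 2 * pi / n%:R :> R by rewrite divr_gt0 //; lra.
have dist : `|th - ang R n k| <= 2 * pi / n%:R.
  have -> : th - ang R n k = 2 * pi / n%:R * (z - k%:R).
    by rewrite {1}thz /ang; field; rewrite gt_eqF.
  rewrite normrM (gtr0_norm pn0) -[leRHS]mulr1 ler_wpM2l ?(ltW pn0) //.
  rewrite ler_norml; rewrite -natr1 in k2; lra.
have cosge : 1 - 2 * pi / n%:R <= cos (th - ang R n k).
  have := cos_lip 0 (th - ang R n k); rewrite cos0 sub0r normrN => h.
  have := le_trans h dist; rewrite ler_norml; lra.
have : r * (1 - 2 * pi / n%:R) <= r * cos (th - ang R n k) by rewrite ler_wpM2l.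
move=> h; apply: (le_trans h); case: H => H; rewrite (H k).
  exact: ler_norm.
by rewrite normrN; exact: ler_norm.
Qed.

End Wave.

Section Native.
Variables (R : realType) (n : nat) (c : 'I_n -> R).
Hypotheses (n3 : (3 <= n)%N) (c0 : forall i, 0 < c i).
Let n_gt0 : (0 < n)%N. Proof. exact: ltnW (ltnW n3). Qed.
Let S := total_res c.
Let del := delta_n c.
Let nR : 0 < n%:R :> R. Proof. by rewrite ltr0n. Qed.
Let S0 : 0 < S. Proof. exact: total_gt0. Qed.
Let rp := rpos c n_gt0.
Implicit Types p q : 'I_n.

Lemma rpos_mono i j : (i <= j)%N -> rp i <= rp j.
Proof.
move=> ij; rewrite -(subnKC ij); elim: (j - i)%N => [|k IH]; first by rewrite addn0.
by rewrite addnS /rp rposS -/rp; apply: (le_trans IH); rewrite lerDl ltW // res_gt0.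
Qed.

Lemma rpos_bounds p : 0 <= rp p <= S.
Proof.
have := rpos_mono (leq0n p); have := rpos_mono (ltnW (ltn_ord p)).
by rewrite /rp rpos0 rposn => -> ->.
Qed.

(** Walking in resistance misses the target by at most one edge. *)
Lemma rpos_hit t : 0 <= t < S -> exists q : 'I_n, `|rp q - t| <= max_res c.
Proof.
move=> /andP[t0 tS].
have ex : exists k, t < rp k by exists n; rewrite /rp rposn.
case: (ex_minnP ex) => -[|k] hk hmin; first by move: hk; rewrite /rp rpos0 ltNge t0.
have kn : (k < n)%N by apply: hmin; rewrite /rp rposn.
exists (Ordinal kn).
have tk : rp k <= t.
  by rewrite leNgt; apply/negP => /hmin; rewrite ltnn.
move: hk; rewrite /rp rposS -/rp => hk.
have := res_le_max c (vtx n_gt0 k); rewrite /= ler_norml /rp in tk hk *; lra.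
Qed.

Lemma near_antipodalP p q z : `| `|rp p - rp q| - S / 2 | <= z -> near_antipodal c z p q.
Proof.
rewrite /near_antipodal /res_dist !(posE c n_gt0) -/rp -/S.
set a := `|rp p - rp q|; rewrite minEle; case: ifP => _ //.
have -> : (S - a - S / 2) = - (a - S / 2) by field.
by rewrite normrN.
Qed.

(** Walk half of the total resistance, in the direction that does not cross the
    origin. As the discrepancy is small, the index moves by nearly n / 2, so that
    every wave changes sign. *)
Lemma native_antipode p : exists q,
  near_antipodal c (max_res c) p q /\
  forall x y : R, x ^+ 2 + y ^+ 2 <= 4 ->
    `|wave n x y p + wave n x y q| <= 100 * del.
Proof.
have /andP[p0 pS] := rpos_bounds p.
have S0' := S0.
pose sg : R := if rp p < S / 2 then 1 else -1.
have sgE : sg = 1 \/ sg = -1 by rewrite /sg; case: ifP; [left|right].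
pose t := rp p + sg * (S / 2).
have t01 : 0 <= t < S.
  by rewrite /t /sg; case: ltP => h; apply/andP; split; lra.
have [q hq] := rpos_hit t01; exists q; split.
  apply: near_antipodalP.
  move: hq; rewrite /t !ler_norml => /andP[q1 q2].
  case: sgE => e; rewrite e in q1 q2.
    have -> : `|rp p - rp q| = `|rp q - rp p| by rewrite distrC.
    have [h|h] := leP 0 (rp q - rp p); [rewrite (ger0_norm h)|rewrite (ltr0_norm h)]; lra.
  have [h|h] := leP 0 (rp p - rp q); [rewrite (ger0_norm h)|rewrite (ltr0_norm h)]; lra.
move=> x y xy4.
have hmax := max_res_le n_gt0 c0; rewrite -/S -/del in hmax.
have := rpos_close n_gt0 c0 p; have := rpos_close n_gt0 c0 q.
rewrite -/rp -/S -/del => dq dp.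
have pp := pi_gt0 R; have p4 := pi_le4 R.
have nS := gt_eqF S0; have nn := gt_eqF nR.
have d0 : 0 <= del.
  by rewrite -(pmulr_lge0 _ S0); apply: le_trans hmax; apply: le_trans (res_le_max c p); rewrite ltW // res_gt0.
pose e := ang R n q - (ang R n p + sg * pi).
have he : `|e| <= 24 * del.
  have -> : e = 2 * pi / S * (q%:R * (S / n%:R) - p%:R * (S / n%:R) - sg * (S / 2)).
    by rewrite /e /ang; field; rewrite nS nn.
  rewrite normrM ger0_norm; last by rewrite divr_ge0 ?(ltW S0) //; lra.
  apply: (@le_trans _ _ (2 * pi / S * (3 * (del * S)))).
    rewrite ler_wpM2l //; first by rewrite divr_ge0 ?(ltW S0) //; lra.
    move: hq dp dq; rewrite /t !ler_norml; lra.
  have -> : 2 * pi / S * (3 * (del * S)) = 6 * pi * del by field; rewrite nS.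
  by rewrite ler_wpM2r //; lra.
have cs : cos (ang R n p + sg * pi) = - cos (ang R n p).
  case: sgE => ->; rewrite ?mul1r ?mulN1r; first by rewrite cosDpi.
  by rewrite cosB cospi sinpi; ring.
have sn : sin (ang R n p + sg * pi) = - sin (ang R n p).
  case: sgE => ->; rewrite ?mul1r ?mulN1r; first by rewrite sinDpi.
  by rewrite sinB cospi sinpi; ring.
have hc := cos_lip (ang R n q) (ang R n p + sg * pi).
have hs := sin_lip (ang R n q) (ang R n p + sg * pi).
rewrite -/e cs opprK in hc; rewrite -/e sn opprK in hs.
have lt2 (z : R) : z ^+ 2 <= 4 -> `|z| <= 2.
  by move=> h; rewrite -ler_sqr ?nnegrE // real_normK ?num_real //; lra.
have x2 : `|x| <= 2 by apply: lt2; have := sqr_ge0 y; lra.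
have y2 : `|y| <= 2 by apply: lt2; have := sqr_ge0 x; lra.
have -> : wave n x y p + wave n x y q = x * (cos (ang R n q) + cos (ang R n p)) +
   y * (sin (ang R n q) + sin (ang R n p)) by rewrite /wave; ring.
apply: le_trans (ler_normD _ _) _; rewrite !normrM.
have h1 : `|x| * `|cos (ang R n q) + cos (ang R n p)| <= 2 * (24 * del).
  by apply: ler_pM => //; apply: le_trans hc he.
have h2 : `|y| * `|sin (ang R n q) + sin (ang R n p)| <= 2 * (24 * del).
  by apply: ler_pM => //; apply: le_trans hs he.
lra.
Qed.

(** Adjacent vertices are at resistance distance at most S / 8, nearly antipodal
    ones at least 3 S / 8. *)
Lemma near_antipodal_chord z p q : max_res c <= z -> z <= S / 8 ->
  near_antipodal c z p q -> chord p q.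
Proof.
move=> mz zS; rewrite /near_antipodal /res_dist !(posE c n_gt0) -/rp -/S ler_norml.
set a := `|rp p - rp q| => /andP[h _].
have S0' := S0.
have ha : 3 / 8 * S <= Num.min a (S - a) by lra.
rewrite le_min in ha; case/andP: ha => a1 a2.
have adj (p' q' : 'I_n) : q' = ordS p' -> `|rp p' - rp q'| <= S / 8 \/ S - `|rp p' - rp q'| <= S / 8.
  move=> ->; have rm := res_le_max c p'; have r0 := res_gt0 c0 p'.
  have rS : rp p'.+1 = rp p' + res c p' by rewrite /rp rposS vtx_ord.
  have [pn|np] := ltnP p'.+1 n.
    left; rewrite /= modn_small // rS opprD addrA subrr add0r normrN gtr0_norm //.
    lra.
  have pn : p'.+1 = n by apply/eqP; rewrite eqn_leq np andbT.
  right; rewrite /= [in (_ %% _)%N]pn modnn /rp rpos0 -/rp subr0.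
  have := rposn c n_gt0; rewrite -[X in rpos _ _ X]pn -/rp rS -/S => e.
  have /andP[b1 b2] := rpos_bounds p'; rewrite ger0_norm //; lra.
apply/and3P; split.
- by apply/eqP => e; move: a1; rewrite /a e subrr normr0; lra.
- by apply/eqP => e; case: (adj _ _ e); rewrite -/a; lra.
- by apply/eqP => e; case: (adj _ _ e); rewrite distrC -/a; lra.
Qed.

End Native.

(** * Gain of the maximizer *)

Section Main.
Variables (R : realType) (n : nat) (c : 'I_n -> R) (u : nat -> 'cV[R]_n).
Hypotheses (n3 : (3 <= n)%N) (c0 : forall i, 0 < c i).
Let L := laplacian c.
Let S := total_res c.
Let del := delta_n c.
Hypotheses (uP : orthonormal_eigenbasis L u)
  (u0 : u 0%N = const_mx (Num.sqrt n%:R)^-1).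
(** A common bound for the errors of the profiles and of sqrt (lambda_k n S). *)
Let eps := 60 * (100 * (100 * del)).
Hypothesis eps_small : eps <= 1 / 20 / 50.
Let n_gt0 : (0 < n)%N. Proof. exact: ltnW (ltnW n3). Qed.
Let nR : 0 < n%:R :> R. Proof. by rewrite ltr0n. Qed.
Let S0 : 0 < S. Proof. exact: total_gt0. Qed.
Let P0 : 0 < n%:R * S. Proof. exact: mulr_gt0. Qed.
Let nd : 1 <= del * n%:R. Proof. exact: delta_n_ge. Qed.
Let d0 : 0 < del.
Proof. by rewrite -(pmulr_lgt0 _ nR); apply: lt_le_trans nd. Qed.
Let sL : L^T = L. Proof. exact: laplacian_sym. Qed.

Lemma n_gt3 : (3 < n)%N.
Proof.
have ? := nd; have es := eps_small; have ? := nR.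
rewrite -(ltr_nat R).
have : del * n%:R <= 1 / 20 / 50 * n%:R.
  by rewrite ler_wpM2r ?(ltW nR) //; rewrite /eps in es *; lra.
lra.
Qed.

Lemma lambda1_ge : 1 <= lambda L 1 * (n%:R * S).
Proof.
have n1 : (1 < n)%N by apply: leq_trans n3.
have := poincare n_gt0 c0 (eigen_perp_const n_gt3 uP u0 (k := 1) n1).
rewrite -/L -/S (basis_eigen uP n1) dotZr (basis_dot uP n1 n1) eqxx mulr1.
by rewrite mulrC.
Qed.

Lemma profile_of k : (0 < k < n)%N -> lambda L k * (n%:R * S) <= (3 * pi) ^+ 2 ->
  `|Num.sqrt (lambda L k * (n%:R * S)) - 2 * pi| <= eps /\
  exists x y, has_profile (u k) x y eps.
Proof.
move=> /andP[k0 kn] hk; have es := eps_small; have ? := d0.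
have kk := basis_dot uP kn kn; rewrite eqxx /= in kk.
have lk : 1 <= lambda L k * (n%:R * S).
  apply: le_trans lambda1_ge _; rewrite ler_wpM2r ?(ltW P0) //.
  by apply: (lambda_mono sL); rewrite k0.
have sm : 40 * (50 * (100 * del)) <= 1 / 4 by rewrite /eps in es *; lra.
have lk2 : 1 <= lambda L k * (n%:R * S) <= (3 * pi) ^+ 2 by rewrite lk hk.
have [h [x [y hxy]]] := eigenvector_profile n3 c0 sm kk (basis_eigen uP kn) lk2.
rewrite -/S -/del in h hxy; split.
  by apply: le_trans h _; rewrite /eps; lra.
exists x, y; have -> // : eps = 3 * (40 * (50 * (100 * del))) by rewrite /eps; ring.
Qed.

Let l2_le : lambda L 2 * (n%:R * S) <= (3 * pi) ^+ 2.
Proof.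
have es := eps_small; have ? := d0; apply: (lambda2_le n3 c0 _ uP u0).
by rewrite -/del; rewrite /eps in es *; lra.
Qed.

Let l1_le : lambda L 1 * (n%:R * S) <= (3 * pi) ^+ 2.
Proof.
by apply: le_trans l2_le; rewrite ler_wpM2r ?(ltW P0) //; exact: (lambda_mono sL).
Qed.

Let eps01 : 0 <= eps <= 1.
Proof. by have es := eps_small; have ? := d0; rewrite /eps in es *; lra. Qed.

Lemma profile_gram j k x y x' y' : (j < n)%N -> (k < n)%N ->
  has_profile (u j) x y eps -> has_profile (u k) x' y' eps ->
  `|(j == k)%:R - (x * x' + y * y')| <= 10 * eps.
Proof.
move=> jn kn hj hk; rewrite -(basis_dot uP jn kn).
exact: (profile_dot n3 eps01 hj hk).
Qed.

(** Otherwise u_1, u_2, u_3 would have profiles in the same plane. *)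
Lemma lambda3_ge : (3 * pi) ^+ 2 <= lambda L 3 * (n%:R * S).
Proof.
rewrite leNgt; apply/negP => /ltW h3.
have n1 : (1 < n)%N by exact: leq_trans n3.
have [_ [x1 [y1 q1]]] := profile_of (k := 1) n1 l1_le.
have [_ [x2 [y2 q2]]] := profile_of (k := 2) n3 l2_le.
have [_ [x3 [y3 q3]]] := profile_of (k := 3) n_gt3 h3.
have := eps01; have := eps_small => es /andP[e0 _].
have g11 := profile_gram n1 n1 q1 q1; have g22 := profile_gram n3 n3 q2 q2.
have g33 := profile_gram n_gt3 n_gt3 q3 q3; have g12 := profile_gram n1 n3 q1 q2.
have g13 := profile_gram n1 n_gt3 q1 q3; have g23 := profile_gram n3 n_gt3 q2 q3.
rewrite /= !sub0r !normrN in g11 g22 g33 g12 g13 g23.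
have t01 : 0 <= 10 * eps <= 1 / 10 by apply/andP; split; lra.
exact: (no_three t01 g11 g22 g33 g12 g13 g23).
Qed.

(** Both square roots are within eps of 2 pi. *)
Lemma gap_le : (lambda L 2 - lambda L 1) * (n%:R * S) <= 40 * eps.
Proof.
have n1 : (1 < n)%N by exact: leq_trans n3.
have [h1 _] := profile_of (k := 1) n1 l1_le.
have [h2 _] := profile_of (k := 2) n3 l2_le.
have p4 := pi_le4 R; have := eps01 => /andP[e0 e1].
have l11 := lambda1_ge.
have l22 : 0 <= lambda L 2 * (n%:R * S).
  apply: le_trans (le_trans ler01 l11) _; rewrite ler_wpM2r ?(ltW P0) //.
  exact: (lambda_mono sL).
set q1 := Num.sqrt (lambda L 1 * _) in h1; set q2 := Num.sqrt (lambda L 2 * _) in h2.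
have -> : (lambda L 2 - lambda L 1) * (n%:R * S) = (q2 - q1) * (q2 + q1).
  rewrite mulrBl -(sqr_sqrtr l22) -(sqr_sqrtr (le_trans ler01 l11)) -/q1 -/q2; ring.
have q10 : 0 <= q1 by rewrite sqrtr_ge0.
have q20 : 0 <= q2 by rewrite sqrtr_ge0.
move: h1 h2; rewrite !ler_norml => /andP[a1 b1] /andP[a2 b2].
have -> : 40 * eps = (2 * eps) * 20 by ring.
apply: (@le_trans _ _ ((2 * eps) * (q2 + q1))).
  by rewrite ler_wpM2r ?addr_ge0 //; lra.
by rewrite ler_wpM2l //; lra.
Qed.

Lemma lambda3_ge2 : 2 * lambda L 2 <= lambda L 3.
Proof.
have [h2 _] := profile_of (k := 2) n3 l2_le.
have l3 := lambda3_ge.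
have p4 := pi_le4 R; have p2 := pi_ge2 R; have := eps01 => /andP[e0 e1].
have es := eps_small.
have l22 : 0 <= lambda L 2 * (n%:R * S).
  apply: le_trans (le_trans ler01 lambda1_ge) _; rewrite ler_wpM2r ?(ltW P0) //.
  exact: (lambda_mono sL).
rewrite -(ler_pM2r P0); apply: le_trans l3.
rewrite -mulrA -(sqr_sqrtr l22).
set q2 := Num.sqrt (lambda L 2 * _) in h2 *.
have q20 : 0 <= q2 by rewrite sqrtr_ge0.
move: h2; rewrite ler_norml => /andP[a2 b2].
have qle : q2 <= 21 / 10 * pi by lra.
have : q2 ^+ 2 <= (21 / 10 * pi) ^+ 2 by rewrite ler_sqr ?nnegrE //; lra.
have := sqr_ge0 (@pi R); rewrite !exprMn; lra.
Qed.

Let s := Num.sqrt (n%:R / 2 : R).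
Let s2 : s ^+ 2 = n%:R / 2.
Proof. by rewrite sqr_sqrtr // divr_ge0 // ltW. Qed.

Lemma profile_diff v x y (p q : 'I_n) : has_profile v x y eps ->
  `|s * (v p 0 - v q 0) - (wave n x y p - wave n x y q)| <= 2 * eps.
Proof.
move=> [_ h]; have := h p; have := h q; rewrite -/s => hq hp.
have -> : s * (v p 0 - v q 0) - (wave n x y p - wave n x y q) =
  (s * v p 0 - wave n x y p) - (s * v q 0 - wave n x y q) by ring.
apply: le_trans (ler_normB _ _) _; lra.
Qed.

(** Comparison with the native antipodal pair makes beta_1 nearly maximal; by
    Bessel's inequality little is left for the second mode. *)
Lemma maximizer_modes z p q : max_res c <= z -> beta1_maximizer c u z p q ->
  3 <= n%:R / 2 * beta1 u p q ^+ 2 /\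
  n%:R / 2 * (u 2%N p 0 - u 2%N q 0) ^+ 2 <= 4 * (100 * eps).
Proof.
move=> mz [_ hmax].
have n1 : (1 < n)%N by exact: leq_trans n3.
have [_ [x1 [y1 q1]]] := profile_of (k := 1) n1 l1_le.
have [_ [x2 [y2 q2]]] := profile_of (k := 2) n3 l2_le.
have es := eps_small; have /andP[e0 e1] := eps01; have hd0 := d0; have hnd := nd.
have g11 := profile_gram n1 n1 q1 q1; have g22 := profile_gram n3 n3 q2 q2.
have g12 := profile_gram n1 n3 q1 q2.
rewrite /= sub0r normrN in g12; rewrite /= in g11 g22.
have s0 : 0 <= s by rewrite sqrtr_ge0.
have dele : 200 * del <= eps by rewrite /eps; lra.
pose r := Num.sqrt (x1 ^+ 2 + y1 ^+ 2).
have r2 : r ^+ 2 = x1 ^+ 2 + y1 ^+ 2 by rewrite sqr_sqrtr // addr_ge0 ?sqr_ge0.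
have r0 : 0 <= r by rewrite sqrtr_ge0.
have r4 : r <= 2.
  by rewrite -ler_sqr ?nnegrE // r2; case: q1 => q1 _; lra.
have rge : 1 - 10 * eps <= r.
  rewrite -ler_sqr ?nnegrE //; last lra.
  rewrite r2; move: g11; rewrite ler_norml => /andP[_ g11].
  have : (1 - 10 * eps) ^+ 2 <= 1 - 10 * eps.
    by rewrite expr2 -[leRHS]mulr1 ler_wpM2l //; lra.
  rewrite -!expr2 in g11; lra.
(* The peak misses the phase of u_1 by at most 2 pi / n <= 8 del, the antipode
   costs 100 del and the two profiles 2 eps. *)
have peak : exists p' q', near_antipodal c z p' q' /\ 2 * r - 3 * eps <= s * `|beta1 u p' q'|.
  have [p' hp'] := wave_peak n3 x1 y1.
  have [q' [nq hq']] := native_antipode n3 c0 p'.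
  exists p', q'; split; first exact: le_trans nq mz.
  have xy4 : x1 ^+ 2 + y1 ^+ 2 <= 4 by case: q1.
  have := hq' _ _ xy4; rewrite -/del => ha.
  have pf := profile_diff p' q' q1; rewrite -/(beta1 u p' q') in pf.
  have -> : s * `|beta1 u p' q'| = `|s * beta1 u p' q'| by rewrite normrM (ger0_norm s0).
  have pn : 2 * pi / n%:R <= 8 * del.
    rewrite ler_pdivrMr // -mulrA; have := pi_le4 R; lra.
  have rp : r * (2 * pi / n%:R) <= 2 * (8 * del).
    by apply: ler_pM => //; rewrite divr_ge0 ?(ltW nR) // mulr_ge0 // pi_ge0.
  rewrite -/r mulrBr mulr1 in hp'.
  have t1 : 2 * `|wave n x1 y1 p'| - `|wave n x1 y1 p' + wave n x1 y1 q'| <=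
      `|wave n x1 y1 p' - wave n x1 y1 q'|.
    set a := wave _ _ _ p'; set b := wave _ _ _ q'.
    have -> : 2 * `|a| = `|(a + b) + (a - b)|.
      rewrite (_ : a + b + (a - b) = 2 * a); last by ring.
      by rewrite normrM ger0_norm.
    have := ler_normD (a + b) (a - b); lra.
  have t2 := ler_distD 0 (s * beta1 u p' q') (wave n x1 y1 p' - wave n x1 y1 q').
  have t3 : `|wave n x1 y1 p' - wave n x1 y1 q'| <= `|s * beta1 u p' q'| + 2 * eps.
    rewrite -[X in `|X|](subrK (s * beta1 u p' q')).
    apply: le_trans (ler_normD _ _) _; rewrite addrC lerD2l distrC; exact: pf.
  lra.
have [p' [q' [na hb]]] := peak.
have hb2 : 2 * r - 3 * eps <= s * `|beta1 u p q|.
  by apply: le_trans hb _; rewrite ler_wpM2l // hmax.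
have pf1 := profile_diff p q q1; rewrite -/(beta1 u p q) in pf1.
have pf2 := profile_diff p q q2.
pose Dc := cos (ang R n p) - cos (ang R n q).
pose Ds := sin (ang R n p) - sin (ang R n q).
have wE x y : wave n x y p - wave n x y q = x * Dc + y * Ds by rewrite /wave /Dc /Ds; ring.
rewrite !wE in pf1 pf2.
set B1 := x1 * Dc + y1 * Ds in pf1; set B2 := x2 * Dc + y2 * Ds in pf2.
have D4 : Dc ^+ 2 + Ds ^+ 2 <= 4.
  rewrite /Dc /Ds chord_sqr; set sn := sin _.
  have : sn ^+ 2 <= 1 by rewrite -real_normK ?num_real // expr_le1 // sin_max.
  lra.
have te0 : 0 <= 10 * eps by lra.
have bes := plane_bessel Dc Ds te0 g11 g22 g12.
rewrite -/B1 -/B2 in bes.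
have bes2 : B1 ^+ 2 + B2 ^+ 2 <= 4 + 80 * eps.
  apply: (le_trans bes); have -> : 4 + 80 * eps = (1 + 2 * (10 * eps)) * 4 by ring.
  by rewrite ler_wpM2l //; lra.
have sb1 : s * `|beta1 u p q| = `|s * beta1 u p q| by rewrite normrM (ger0_norm s0).
have b1ge : 2 - 25 * eps <= `|B1|.
  have : `|s * beta1 u p q| <= `|B1| + 2 * eps.
    rewrite -[X in `|X|](subrK B1); apply: le_trans (ler_normD _ _) _.
    by rewrite addrC lerD2l.
  lra.
have B1sq : 4 - 100 * eps <= B1 ^+ 2.
  rewrite -[X in _ <= X]real_normK ?num_real //.
  have : (2 - 25 * eps) ^+ 2 <= `|B1| ^+ 2 by rewrite ler_sqr ?nnegrE //; lra.
  have -> : (2 - 25 * eps) ^+ 2 = 4 - 100 * eps + 625 * eps ^+ 2 by ring.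
  have := sqr_ge0 eps; lra.
split.
  have -> : n%:R / 2 * beta1 u p q ^+ 2 = (s * `|beta1 u p q|) ^+ 2.
    by rewrite exprMn s2 real_normK ?num_real.
  have h2 : 19 / 10 <= s * `|beta1 u p q| by lra.
  have : 19 / 10 * (19 / 10) <= s * `|beta1 u p q| * (s * `|beta1 u p q|).
    by apply: ler_pM => //; lra.
  by rewrite expr2; lra.
have -> : n%:R / 2 * (u 2%N p 0 - u 2%N q 0) ^+ 2 = (s * (u 2%N p 0 - u 2%N q 0)) ^+ 2.
  by rewrite exprMn s2.
set b := s * _ in pf2 *.
have : (b - B2) ^+ 2 <= (2 * eps) ^+ 2.
  by rewrite -[X in X <= _]real_normK ?num_real // ler_sqr ?nnegrE //; lra.
have e2 : eps ^+ 2 <= eps by rewrite expr2 -[leRHS]mulr1 ler_wpM2l.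
have := sqr_ge0 (b - 2 * B2); rewrite exprMn; lra.
Qed.

(** The choice tau = 400 eps makes the contribution of the second mode at most 1
    and the smallness of the gap bounds the other one by 1, after multiplication
    by n / 2, against at least 3 for the first mode. *)
Lemma loss_le w Cw z p q : 0 < w -> 0 < Cw -> w^-1 <= Cw * mean_res c ->
  20 * eps * (Cw + 2) <= 1 -> max_res c <= z -> beta1_maximizer c u z p q ->
  (lambda L 2 - lambda L 1) * (1 - 4 * (100 * eps)) <= gain c w p q.
Proof.
move=> w0 Cw0 hw hC mz hm; have [b1 b2] := maximizer_modes mz hm.
have /andP[e0 e1] := eps01; have es := eps_small; have hd0 := d0; have hn := nR; have hS := S0.
set g := lambda L 2 - lambda L 1.
have g0 : 0 <= g by rewrite subr_ge0; exact: (lambda_mono sL).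
have [ge|gn] := eqVneq g 0.
  by rewrite ge mul0r; exact: (gain_ge0 n_gt3 w0 uP u0).
have gp : 0 < g by rewrite lt_neqAle eq_sym gn.
have ep : 0 < eps by rewrite /eps; lra.
apply: (gain_lower n_gt3 c0 w0 uP u0) => //.
- by rewrite -(pmulr_lgt0 _ P0); apply: lt_le_trans lambda1_ge.
- by rewrite -subr_gt0.
- exact: lambda3_ge2.
- by apply/andP; split; lra.
rewrite -/L -/S -/g.
have hn2 : 0 < n%:R / 2 :> R by lra.
rewrite -(ler_pM2l hn2) mulrDr.
have c2 : n%:R / 2 * ((u 2%N p 0 - u 2%N q 0) ^+ 2 / (4 * (100 * eps))) <= 1.
  by rewrite [n%:R / 2 * _]mulrA ler_pdivrMr ?mul1r //; lra.
have c1 : n%:R / 2 * (g * (w^-1 + 2 * S)) <= 1.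
  apply: (@le_trans _ _ (n%:R / 2 * (g * (Cw * S + 2 * S)))).
    rewrite ler_wpM2l ?(ltW hn2) // ler_wpM2l // lerD2r; apply: (le_trans hw).
    rewrite ler_wpM2l ?(ltW Cw0) // /mean_res ler_pdivrMr //.
    by rewrite ler_peMr ?(ltW S0) // ler1n.
  have -> : n%:R / 2 * (g * (Cw * S + 2 * S)) = (g * (n%:R * S)) * (Cw + 2) / 2 by field.
  have gl := gap_le; rewrite -/g in gl.
  have : g * (n%:R * S) * (Cw + 2) <= 40 * eps * (Cw + 2) by rewrite ler_wpM2r //; lra.
  lra.
lra.
Qed.

End Main.

Theorem theorem4p8 (R : realType) (kappa Cw : R) (hkappa : 1 <= kappa)
    (hCw : 0 < Cw) :
  exists (delta0 : R) (n0 : nat) (C : R),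
    0 < delta0 /\ 0 < C /\
    forall (n : nat) (c : 'I_n -> R),
      (3 <= n)%N -> (forall i, 1 <= c i <= kappa) ->
      (8 * kappa <= n%:R -> max_res c <= total_res c / 8) /\
      forall (w : R) (u : nat -> 'cV[R]_n),
        0 < w -> w^-1 <= Cw * mean_res c ->
        orthonormal_eigenbasis (laplacian c) u ->
        u 0%N = const_mx (Num.sqrt n%:R)^-1 ->
        delta_n c <= delta0 -> (n0 <= n)%N ->
        (forall (zeta : R) (p q : 'I_n),
          max_res c <= zeta -> zeta <= total_res c / 8 ->
          beta1_maximizer c u zeta p q ->
          (0 <= max_gain c w - gain c w p q <=
             C * (lambda (laplacian c) 2 - lambda (laplacian c) 1) *
             ((zeta / total_res c) ^+ 2 + Num.sqrt (delta_n c))) /\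
          (0 <= max_gain c w - gain c w p q <=
             C * (w / n%:R) *
             ((zeta / total_res c) ^+ 2 + Num.sqrt (delta_n c)))) /\
        (forall p q : 'I_n,
          max_res c <= total_res c / 8 ->
          beta1_maximizer c u (max_res c) p q ->
          0 <= max_gain c w - gain c w p q <=
            C * (w / n%:R) * Num.sqrt (delta_n c)).
Proof.
(* C1 delta_n is the relative loss tau = 400 eps, and g <= 40 Cw (w / n) gives
   the factor 1 + 40 Cw. *)
pose C1 : R := 4 * 100 * (60 * (100 * 100)).
(* This makes eps (Cw + 2) <= 1/1000, as the gap has to be small with respect
   to the conductance of the chord. *)
pose d0 : R := 1 / (60 * (100 * 100)) / (20 * (50 * (Cw + 2))).
exists d0, 0%N, (C1 * (1 + 40 * Cw)).
have Cw2 : 0 < 20 * (50 * (Cw + 2)) by lra.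
have C10 : 0 < C1 by rewrite /C1; lra.
have C14 : 0 <= C1 * (40 * Cw) by rewrite mulr_ge0 //; lra.
split; first by rewrite /d0 divr_gt0 //; lra.
split; first by rewrite mulr_gt0 //; lra.
move=> n c n3 hc; have c0 i : 0 < c i by case/andP: (hc i) => h _; lra.
have n_gt0 : (0 < n)%N by exact: leq_trans n3.
have nR : 1 <= n%:R :> R by rewrite ler1n.
set S := total_res c; have S0 : 0 < S by exact: total_gt0.
split.
  move=> hn; apply: bigmax_le => [|i _]; first by rewrite divr_ge0 // ltW.
  apply: (@le_trans _ _ 1).
    by case/andP: (hc i) => h _; rewrite /res invf_le1.
  rewrite ler_pdivlMr // mul1r.
  have hk : n%:R / kappa <= S.
    have -> : n%:R / kappa = \sum_(i < n) kappa^-1.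
      by rewrite sumr_const card_ord -[RHS]mulr_natl.
    apply: ler_sum => j _; have /andP[cj1 cj2] := hc j.
    by rewrite /res lef_pV2 ?posrE //; lra.
  by apply: le_trans hk; rewrite ler_pdivlMr //; lra.
move=> w u w0 hw uP u0 hd _.
set del := delta_n c in hd *.
set L := laplacian c in uP *.
have nd : 1 <= del * n%:R := delta_n_ge n_gt0 c0.
have del0 : 0 < del.
  by rewrite -(pmulr_lgt0 _ (lt_le_trans ltr01 nR)); apply: lt_le_trans nd.
pose eps := 60 * (100 * (100 * del)).
have e_le : eps * (20 * (50 * (Cw + 2))) <= 1.
  rewrite -ler_pdivlMr //; apply: (@le_trans _ _ (60 * (100 * 100) * d0)).
    by rewrite /eps; lra.
  by rewrite /d0 le_eqVlt; apply/orP; left; apply/eqP; field; rewrite gt_eqF //; lra.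
have e0 : 0 < eps by rewrite /eps; lra.
have eC : 0 <= eps * Cw by rewrite mulr_ge0 // ltW.
have e_small : eps <= 1 / 20 / 50 by lra.
have hC : 20 * eps * (Cw + 2) <= 1 by lra.
have d1 : del <= 1 by rewrite /eps in e_small; lra.
have sq : del <= Num.sqrt del.
  rewrite -ler_sqr ?nnegrE ?sqrtr_ge0 // ?sqr_sqrtr ?(ltW del0) //.
  by rewrite expr2 ler_piMr // ltW.
have n3' := n_gt3 n3 c0 e_small.
set g := lambda L 2 - lambda L 1.
have g0 : 0 <= g.
  by rewrite subr_ge0; apply: (lambda_mono (laplacian_sym c)).
have gw : g <= 40 * Cw * (w / n%:R).
  have gl := gap_le n3 c0 uP u0 e_small; rewrite -/L -/g -/S -/del -/eps in gl.
  have nn0 : 0 < n%:R :> R by lra.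
  have h : n%:R <= Cw * S * w.
    move: hw; rewrite /mean_res -/S mulrA ler_pdivlMr // => hw.
    by rewrite -(ler_pM2l (x := w^-1)) ?invr_gt0 // mulrCA mulVf ?mulr1 ?gt_eqF.
  have gS : g * S <= 40.
    apply: (@le_trans _ _ (g * (n%:R * S))).
      by rewrite mulrCA ler_peMl // mulr_ge0 // ltW.
    lra.
  rewrite mulrA ler_pdivlMr // -(ler_pM2r S0).
  have h1 : g * n%:R * S <= g * (Cw * S * w) * S.
    by rewrite ler_wpM2r ?(ltW S0) // ler_wpM2l.
  apply: (le_trans h1).
  have -> : g * (Cw * S * w) * S = g * S * (Cw * w * S) by ring.
  have -> : 40 * Cw * w * S = 40 * (Cw * w * S) by ring.
  by rewrite ler_wpM2r // !mulr_ge0 // ltW.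
have main zeta p q : max_res c <= zeta -> zeta <= S / 8 -> beta1_maximizer c u zeta p q ->
  0 <= max_gain c w - gain c w p q <= C1 * g * del.
  move=> mz zS hm.
  have chp : chord p q := near_antipodal_chord n3 c0 mz zS hm.1.
  pose G := [set gain c w pq.1 pq.2 | pq in [set pq : 'I_n * 'I_n | chord pq.1 pq.2]]%classic.
  have ubG : ubound G g.
    by move=> _ [[p1 q1] _ <-] /=; exact: gain_le_gap n3' uP p1 q1.
  have Gpq : G (gain c w p q) by exists (p, q).
  have up : max_gain c w <= g by apply: ge_sup => //; exists (gain c w p q).
  have lo : gain c w p q <= max_gain c w.
    by apply: ub_le_sup => //; exists g.
  have := loss_le n3 c0 uP u0 e_small w0 hCw hw hC mz hm.
  rewrite -/L -/g -/del -/eps => ll.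
  rewrite subr_ge0 lo /=.
  have -> : C1 * g * del = g * (4 * (100 * eps)) by rewrite /C1 /eps; ring.
  lra.
have w_n : 0 <= w / n%:R by rewrite divr_ge0 // ltW.
have gd : g * del <= g * Num.sqrt del by rewrite ler_wpM2l.
have sq0 : 0 <= Num.sqrt del by rewrite sqrtr_ge0.
have bound1 : C1 * g * del <= C1 * (1 + 40 * Cw) * g * Num.sqrt del.
  have : C1 * (g * del) <= C1 * (g * Num.sqrt del) by rewrite ler_wpM2l // ltW.
  have : 0 <= C1 * (40 * Cw) * (g * Num.sqrt del).
    by apply: mulr_ge0 => //; apply: mulr_ge0.
  lra.
have bound2 : C1 * g * del <= C1 * (1 + 40 * Cw) * (w / n%:R) * Num.sqrt del.
  have : C1 * (g * del) <= C1 * (g * Num.sqrt del) by rewrite ler_wpM2l // ltW.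
  have : C1 * (g * Num.sqrt del) <= C1 * (40 * Cw * (w / n%:R) * Num.sqrt del).
    by rewrite ler_wpM2l ?(ltW C10) // ler_wpM2r.
  have : 0 <= C1 * (w / n%:R * Num.sqrt del).
    by apply: mulr_ge0; [exact: ltW|apply: mulr_ge0].
  lra.
split=> [zeta p q mz zS hm|p q mz hm].
  have /andP[lo up] := main _ _ _ mz zS hm; rewrite lo /=.
  have z2 : Num.sqrt del <= (zeta / S) ^+ 2 + Num.sqrt del by rewrite lerDr sqr_ge0.
  have CC : 0 <= C1 * (1 + 40 * Cw) by lra.
  split; apply: (le_trans up).
    by apply: (le_trans bound1); rewrite ler_wpM2l // mulr_ge0.
  by apply: (le_trans bound2); rewrite ler_wpM2l // mulr_ge0.
have /andP[lo up] := main _ _ _ (lexx _) mz hm; rewrite lo /=.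
exact: le_trans up bound2.
Qed.
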